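(* Let $\{X_j\}$ be a (strictly) stationary sequence of real random variables with continuous marginal distribution function $F(x)=\mathbb{P}(X_1\le x)$ such that for some constants $b>0$ and $B>0$ $$F(x+u)-F(x)\le B u^b,\qquad x\in\mathbb{R},\ u>0.$$ If $\{X_j\}$ is $\eta$-weakly dependent and $$\eta(r)=\mathcal{O}(r^{-\beta})\quad\text{for some }\beta>2\Big(1+\frac1b\Big),$$ then $\{X_j\}$ admits a continuous phantom distribution function.
   Context: $M_n=\max_{1\le j\le n}X_j$. A distribution function $G$ is a phantom distribution function for the stationary sequence $\{X_j\}$ if $\sup_{u\in\mathbb{R}}|\mathbb{P}(M_n\le u)-G^n(u)|\to 0$ as $n\to\infty$, where $G^n(u)=(G(u))^n$. For $s\in\mathbb{N}$ let $\mathcal{M}^s$ be the family of all measurable non-constant functions $f:\mathbb{R}^s\to\mathbb{R}$ with $\sup|f|\le 1$. For $f\in\mathcal{M}^s$ put $$\mathrm{Lip}\, f=\sup_{(y_1,\dots,y_s)\ne(x_1,\dots,x_s)}\frac{|f(y_1,\dots,y_s)-f(x_1,\dots,x_s)|}{|y_1-x_1|+\cdots+|y_s-x_s|}\in(0,+\infty].$$ The $\eta$-weak dependence coefficient is $$\eta(r)=\sup\frac{\left|\mathrm{Cov}\left(f(X_{i_1},\dots,X_{i_s}),g(X_{j_1},\dots,X_{j_t})\right)\right|}{s\,\mathrm{Lip}\, f+t\,\mathrm{Lip}\, g},$$ the supremum being over all $s,t\in\mathbb{N}$, $f\in\mathcal{M}^s$, $g\in\mathcal{M}^t$ and all indices $i_1\le\cdots\le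 i_s\le j_1\le\cdots\le j_t$ with $j_1-i_s\ge r$ (the ratio is $0$ when the denominator is $+\infty$). The sequence is $\eta$-weakly dependent if $\eta(r)\to 0$ as $r\to\infty$. *)

(* Defs.v *)
From HB Require Import structures.
From mathcomp Require Import all_boot all_order all_algebra.
From mathcomp Require Import all_classical all_reals all_analysis.

Set Implicit Arguments.
Unset Strict Implicit.
Unset Printing Implicit Defensive.

Import Order.TTheory GRing.Theory Num.Theory.
Import numFieldNormedType.Exports.

Local Open Scope classical_set_scope.
Local Open Scope ring_scope.

(* Sequences are indexed from 0: [X j] below is the random variable written
   X_{j+1} when the index starts at 1. *)
Section Sequences.
Context (d : measure_display) (T : measurableType d) (R : realType)
  (P : probability T R).
Implicit Type X : nat -> {RV P >-> R}.

Definition vec X n (k : n.-tuple nat) (w : T) : n.-tuple R :=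
  [tuple of map (fun j => X j w) k].

Definition strictly_stationary X : Prop :=
  forall (n : nat) (k : n.-tuple nat) (h : nat) (A : set (n.-tuple R)),
    measurable A ->
    P (vec X [tuple of map (addn h) k] @^-1` A) = P (vec X k @^-1` A).

(* max (X 0, ..., X n.-1); the default value [X 0 w] is only the junk value
   of the empty maximum n = 0. *)
Definition partial_max X (n : nat) (w : T) : R :=
  \big[Num.max/X 0%N w]_(j < n) X j w.

Definition phantom_distribution X (G : cumulativeBounded (0 : R) (1 : R)) :
    Prop :=
  ereal_sup [set `|fine (P [set w | partial_max X n w <= u]) - G u ^+ n|%:E
            | u in [set: R]] @[n --> \oo] --> 0%E.

End Sequences.

Section EtaCoefficient.
Context (R : realType).

Definition test_function (s : nat) : set (s.-tuple R -> R) :=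
  [set f : s.-tuple R -> R | [/\ measurable_fun [set: s.-tuple R] f,
              exists x y, f x <> f y
            & forall x, `|f x| <= 1]].

Definition l1dist (s : nat) (x y : s.-tuple R) : R :=
  \sum_(k < s) `|tnth y k - tnth x k|.

Definition Lip (s : nat) (f : s.-tuple R -> R) : \bar R :=
  ereal_sup [set (`|f z.2 - f z.1| / l1dist z.1 z.2)%:E
            | z in [set z : s.-tuple R * s.-tuple R | z.2 != z.1]].

Context (d : measure_display) (T : measurableType d) (P : probability T R).

(* The test functions have s.+1 and t.+1 arguments, so that both numbers of
   arguments range over the positive integers. In [\bar R], +oo^-1 = 0: the
   ratio vanishes when its denominator is +oo. The coefficient itself may be
   +oo. *)
Definition eta (X : nat -> {RV P >-> R}) (r : nat) : \bar R :=
  ereal_sup [set q : \bar R |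
    exists (s t : nat) (f : s.+1.-tuple R -> R) (g : t.+1.-tuple R -> R)
           (i : s.+1.-tuple nat) (j : t.+1.-tuple nat),
      [/\ test_function f /\ test_function g,
          sorted leq (i ++ j),
          (r <= tnth j ord0 - tnth i ord_max)%N
        & q = (`|covariance P (f \o vec X i) (g \o vec X j)|
               / (s.+1%:R%:E * Lip f + t.+1%:R%:E * Lip g))%E]].

Definition eta_weakly_dependent (X : nat -> {RV P >-> R}) : Prop :=
  eta X r @[r --> \oo] --> 0%E.

End EtaCoefficient.

(* Main.v *)
From HB Require Import structures.
Require Import Defs.
From mathcomp Require Import all_boot all_order all_algebra.
From mathcomp Require Import all_classical all_reals all_analysis.
From mathcomp Require Import measurable_realfun.
From mathcomp Require Import zify ring lra.

Set Implicit Arguments.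
Unset Strict Implicit.
Unset Printing Implicit Defensive.

Import Order.TTheory GRing.Theory Num.Theory.
Import numFieldNormedType.Exports.
Local Open Scope classical_set_scope.
Local Open Scope ring_scope.

(** Let [a n u] be the probability that [X 0, ..., X n.-1] are all at most [u].
    Two blocks of length at most [r ^ 2] separated by a gap of length [r] are
    almost independent, uniformly in [u]: replace indicators by functions that
    are Lipschitz at scale [r ^ -(2/b + k)], with [k > 0] small, and use
    [beta > 2 (1 + 1/b)]. Unless [a n u] is already small, a block of length
    [o(n)] exceeds [u] with vanishing probability, so the gap can be filled and
    [a (p + q) u] is close to [a p u * a q u] for [p, q = O(n)]. Hyers'
    stability argument applied to [ln a] then gives [a n u ~ exp (- n / N u)]
    uniformly in [n] and [u], where [N u] is the first [n] with
    [a n u <= 1/e]. The integer [N u] is not continuous in [u], but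
    [S u = \sum_(n >= 1) max (a n u - 1/e) 0] is, and it is equivalent to
    [c * N u] with [c = 1 - 2/e] as [N u] tends to infinity; hence
    [G = S / (S + c)] is a continuous phantom distribution function. *)

(** * Almost multiplicative sequences *)

Lemma natr_divS_le1 (R : realFieldType) (k : nat) : k%:R / k.+1%:R <= 1 :> R.
Proof. by rewrite ler_pdivrMr ?ltr0n// mul1r ler_nat. Qed.

Lemma exists_expr_le (R : realType) (g e : R) :
  0 <= g -> g < 1 -> 0 < e -> exists k : nat, g ^+ k <= e.
Proof.
move=> g0 g1 e0.
have /cvgrPdist_le /(_ _ e0) [k _ /(_ k (leqnn k))] : g ^+ n @[n --> \oo] --> (0 : R).
  by apply: cvg_expr; rewrite ger0_norm.
by rewrite /= sub0r normrN => h; exists k; apply: le_trans h; rewrite ler_norm.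
Qed.

(** Take [r = T * s.+1] with [s] the integer square root of [N]: blocks of length [r ^ 2] cover
    [T * N], while [k] blocks of length [r] fit below [N]. *)
Lemma exists_intermediate_scale (T k r0 : nat) : (0 < k)%N -> (0 < T)%N ->
  exists N0, forall N, (N0 <= N)%N ->
  exists r, [/\ (r0 <= r)%N, (T * N <= r ^ 2)%N & (k * r <= N)%N].
Proof.
move=> k0 T0; exists ((2 * k * T + r0).+1 ^ 2)%N => N hN.
have [s [h1 h2]] : exists s, (s ^ 2 <= N)%N /\ (N < s.+1 ^ 2)%N.
  elim: N {hN} => [|N [s [h1 h2]]]; first by exists 0%N.
  have [h|h] := leqP (s.+1 ^ 2) N.+1; last by exists s; split=> //; apply: leqW.
  exists s.+1; split=> //; apply: (leq_trans (n := s.+1 ^ 2 + 1)); first by lia.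
  by rewrite !expnS !expn0; nia.
have hs : (2 * k * T + r0 < s.+1)%N.
  rewrite ltnS; have : ((2 * k * T + r0).+1 ^ 2 < s.+1 ^ 2)%N by apply: leq_ltn_trans h2.
  by rewrite ltn_exp2r //; lia.
exists (T * s.+1)%N; split; first by nia.
  move: h1 h2; rewrite !expnS !expn0 !muln1 => h1 h2.
  apply: (leq_trans (n := T * (s.+1 * s.+1))); first by rewrite leq_mul2l ltnW ?orbT.
  by rewrite mulnACA leq_mul2r; apply/orP; right; nia.
apply: leq_trans h1; rewrite !expnS !expn0 muln1; nia.
Qed.

Section ApproximateMultiplicativity.
Context (R : realType) (U : Type) (a : nat -> U -> R).

(* The lower bound has the extra loss [1 - a r u], the probability that a block
   filling the gap exceeds [u]. *)
Definition mixing_at (r : nat) (e : R) : Prop :=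
  forall u p q, (p <= r ^ 2)%N -> (q <= r ^ 2)%N ->
    a (p + r + q)%N u <= a p u * a q u + e /\
    a p u * a q u - e - (1 - a r u) <= a (p + r + q)%N u.

Context (a0 : forall u, a 0 u = 1) (a_ge0 : forall n u, 0 <= a n u)
  (a_anti : forall u m n, (m <= n)%N -> a n u <= a m u)
  (a_drop : forall u q r, a q u - a (q + r)%N u <= 1 - a r u)
  (a_mix : forall e : R, 0 < e ->
     exists r0, forall r, (r0 <= r)%N -> mixing_at r e).

Lemma mixing_le1 n u : a n u <= 1.
Proof. by rewrite -(a0 u) a_anti. Qed.

(** Peel off one block of length [m] and its gap at a time; as all factors are at most 1, the errors
    merely add up. *)
Lemma mixing_iterate e r u m k : mixing_at r e -> 0 <= e -> (k * (m + r) <= r ^ 2)%N ->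
  a (k * (m + r))%N u <= a m u ^+ k + k%:R * e.
Proof.
move=> mix e0; elim: k => [|k IH] hk; first by rewrite mul0n a0 expr0 mul0r addr0.
have hk' : (k * (m + r) <= r ^ 2)%N by apply: leq_trans hk; rewrite leq_mul2r leqnSn orbT.
have hm : (m <= r ^ 2)%N by apply: leq_trans hk; rewrite mulSn; lia.
rewrite mulSn; have [h _] := mix u m (k * (m + r))%N hm hk'.
apply: (le_trans h); rewrite exprS -natr1 mulrDl mul1r addrA lerD2r.
apply: (le_trans (ler_wpM2l (a_ge0 m u) (IH hk'))).
rewrite mulrDr lerD2l ler_piMl ?mixing_le1 // mulr_ge0 ?ler0n //.
Qed.

Lemma eventually_small (m : nat) (g e : R) : 0 <= g -> g < 1 -> 0 < e ->
  exists n0, forall n u, (n0 <= n)%N -> a m u <= g -> a n u <= e.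
Proof.
move=> g0 g1 e0.
have [k hk] := exists_expr_le g0 g1 (divr_gt0 e0 (ltr0n R 2)).
have d0 : 0 < e / 2 / k.+1%:R by rewrite !divr_gt0.
have [r0 mix] := a_mix d0.
(* This size of [r] gives [k * (m + r) <= r ^ 2], the range of [mixing_at]; it does not depend on
   [u]. *)
pose r := (maxn r0 (k * m.+1).+1).
exists (k * (m + r))%N => n u hn hm; apply: (le_trans (a_anti u hn)).
have hr : ((k * m.+1).+1 <= r)%N by rewrite leq_maxr.
have hkr : (k * (m + r) <= r ^ 2)%N by rewrite expnS expn1; nia.
apply: (le_trans (mixing_iterate u (mix r (leq_maxl _ _)) (ltW d0) hkr)).
rewrite [leRHS](splitr e) lerD //.
  by apply: le_trans hk; rewrite lerXn2r ?nnegrE.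
by rewrite mulrCA ler_piMr ?natr_divS_le1 //; lra.
Qed.

(* If a block of length [r] exceeded [u] with probability more than [d], then
   [k] such blocks separated by gaps would fit below [N] and force
   [a N u <= (1 - d) ^+ k + k * e < g]. *)
Lemma exists_negligible_gap (g e d : R) (T : nat) :
  0 < g -> 0 < e -> 0 < d -> d < 1 -> (0 < T)%N ->
  exists N0, forall N u, (N0 <= N)%N -> g <= a N u ->
    exists r, [/\ (0 < r)%N, (T * N <= r ^ 2)%N, mixing_at r e & 1 - a r u <= d].
Proof.
move=> g0 e0 d0 d1 T0.
have [k hk] := @exists_expr_le R (1 - d) (g / 4) ltac:(lra) ltac:(lra) ltac:(lra).
pose e' := Num.min e (g / 4 / k.+1%:R).
have e'0 : 0 < e' by rewrite lt_min e0 /= !divr_gt0.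
have [r0 mix] := a_mix e'0.
have [N0 sc] := @exists_intermediate_scale T (2 * k.+1) (2 * k.+1 + r0) isT T0.
exists N0 => N u hN gN; have [r [hr hT hkr]] := sc N hN.
have mixr := mix r (leq_trans (leq_addl _ _) hr).
have kr : (2 * k.+1 <= r)%N by apply: leq_trans hr; apply: leq_addr.
exists r; split => //.
- by apply: leq_trans kr; rewrite muln_gt0.
- have e'e : e' <= e by rewrite ge_min lexx.
  by move=> v p q hp hq; have [] := mixr v p q hp hq; split; lra.
rewrite leNgt; apply/negP => h.
have hh : (k * (r + r) <= r ^ 2)%N.
  by clear -kr; rewrite !expnS expn0 muln1 addnn -mul2n mulnA leq_mul2r; lia.
have h1 : g <= a (k * (r + r))%N u.
  apply: (le_trans gN); apply: a_anti; apply: leq_trans hkr.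
  by rewrite addnn -mul2n mulnA leq_mul2r; clear; lia.
have h2 : a r u ^+ k <= g / 4.
  by apply: le_trans hk; rewrite lerXn2r ?nnegrE ?a_ge0 //; lra.
have h3 : k%:R * e' <= g / 4.
  apply: (le_trans (y := k%:R * (g / 4 / k.+1%:R))).
    by rewrite ler_wpM2l // ge_min lexx orbT.
  by rewrite mulrCA ler_piMr ?natr_divS_le1 //; lra.
have := mixing_iterate u mixr (ltW e'0) hh; lra.
Qed.

(** The gap satisfies [1 - a r u <= e / 2], so filling it adds only [e / 2] to the mixing error. The
    bound on [1 - a 1 u] later controls the jump across the level [1/e]. *)
Lemma approximately_multiplicative (g e : R) (T : nat) :
  0 < g -> 0 < e -> e < 1 -> (0 < T)%N ->
  exists N0, forall N u, (N0 <= N)%N -> g <= a N u ->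
    1 - a 1 u <= e /\
    forall p q, (p + q <= T * N)%N -> `|a (p + q)%N u - a p u * a q u| <= e.
Proof.
move=> g0 e0 e1 T0.
have [N0 gap] := @exists_negligible_gap g (e / 2) (e / 2) T g0
  ltac:(lra) ltac:(lra) ltac:(lra) T0.
exists N0 => N u hN gN; have [r [r1 hT mixr ar]] := gap N u hN gN.
split; first by have := a_anti u r1; lra.
move=> p q pq; rewrite ler_distl.
have {hT} pq2 := leq_trans pq hT.
have hp := leq_trans (leq_addr q p) pq2.
have hq := leq_trans (leq_addl p q) pq2.
have [_ lo] := mixr u p q hp hq.
have lo' : a (p + r + q)%N u <= a (p + q)%N u by apply: a_anti; rewrite leq_add2r leq_addr.
apply/andP; split; first lra.
(* A second block shorter than the gap has [a q u] close to 1; a longer one gives up its first [r]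
   indices to serve as the gap. *)
have [qr|rq] := ltnP q r.
  have h1 : a (p + q)%N u <= a p u by apply: a_anti; rewrite leq_addr.
  have h2 : a r u <= a q u by apply: a_anti; rewrite ltnW.
  have h3 : a p u * (1 - a q u) <= 1 - a q u.
    by rewrite ler_piMl ?mixing_le1 // subr_ge0 mixing_le1.
  lra.
have [up _] := mixr u p (q - r)%N hp (leq_trans (leq_subr _ _) hq).
move: up; rewrite -addnA subnKC //.
have := a_drop u (q - r) r; rewrite subnK // => h1 up.
have h3 : a p u * (a (q - r)%N u - a q u) <= a (q - r)%N u - a q u.
  by rewrite ler_piMl ?mixing_le1 // subr_ge0 a_anti // leq_subr.
lra.
Qed.

End ApproximateMultiplicativity.

(** * Lipschitz estimates for the logarithm and the exponential *)

Section ExpLn.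
Context {R : realType}.
Implicit Types x y m t : R.

Lemma ln_lipschitz m x y : 0 < m -> m <= x -> m <= y ->
  `|ln x - ln y| <= `|x - y| / m.
Proof.
move=> m0; wlog xy : x y / x <= y => [wl mx my|mx my].
  by have [/wl->//|/ltW/wl] := leP x y; rewrite distrC [`|y - x|]distrC; apply.
have x0 := lt_le_trans m0 mx; have y0 := lt_le_trans m0 my.
rewrite (distrC (ln x)) (distrC x) !ger0_norm ?subr_ge0 ?ler_ln ?posrE//.
rewrite -ln_div ?posrE// (_ : y / x = 1 + (y - x) / x); last by field; rewrite gt_eqF.
apply: le_trans (le_ln1Dx _) _.
  by apply: lt_le_trans (_ : 0 <= _) => //; rewrite ?oppr_lt0 // divr_ge0 ?subr_ge0 // ltW.
by rewrite ler_wpM2l ?subr_ge0 // lef_pV2 ?posrE.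
Qed.

Lemma expR_lipschitz_neg x y : x <= 0 -> y <= 0 -> `|expR x - expR y| <= `|x - y|.
Proof.
wlog xy : x y / x <= y => [wl mx my|x0 y0].
  by have [/wl->//|/ltW/wl] := leP x y; rewrite distrC [`|y - x|]distrC; apply.
rewrite (distrC (expR x)) (distrC x) !ger0_norm ?subr_ge0 ?ler_expR//.
rewrite (_ : x = y + (x - y)); last by ring.
rewrite expRD -{1}[expR y]mulr1 -mulrBr.
have h := expR_ge1Dx (x - y).
have h1 : expR y <= 1 by rewrite expR_le1.
have h2 : expR (x - y) <= 1 by rewrite expR_le1; lra.
have : expR y * (1 - expR (x - y)) <= 1 - expR (x - y) by rewrite ler_piMl // subr_ge0.
have -> : y - (y + (x - y)) = y - x by ring.
lra.
Qed.

(** The constant is uniform in [x] because [x * expR (- (m * x)) <= 2] as soon as [m >= 1/2]. *)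
Lemma expRN_scale_close x t : 0 <= x -> 2^-1 <= t ->
  `|expR (- (t * x)) - expR (- x)| <= 2 * `|t - 1|.
Proof.
move=> x0 ht.
have key m k : 2^-1 <= m -> 0 <= k -> `|expR (- (m * x)) - expR (- ((m + k) * x))| <= 2 * k.
  move=> hm k0; rewrite mulrDl opprD expRD -{1}[expR _]mulr1 -mulrBr.
  have kx : 0 <= k * x by rewrite mulr_ge0.
  have h := expR_ge1Dx (- (k * x)).
  have h1 : expR (- (k * x)) <= 1 by rewrite expR_le1; lra.
  rewrite ger0_norm ?mulr_ge0 ?expR_ge0 ?subr_ge0 //.
  have h2 : expR (- (m * x)) * (1 - expR (- (k * x))) <= expR (- (m * x)) * (k * x).
    by rewrite ler_wpM2l ?expR_ge0 //; lra.
  apply: (le_trans h2).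
  have h3 := expR_ge1Dx (m * x).
  have h4 := expRxMexpNx_1 (m * x).
  have h5 : expR (- (m * x)) * (m * x) <= 1.
    by rewrite -h4 mulrC ler_wpM2r ?expR_ge0 //; lra.
  have h6 : expR (- (m * x)) * (2^-1 * x) <= expR (- (m * x)) * (m * x).
    by rewrite ler_wpM2l ?expR_ge0 // ler_wpM2r.
  have h7 : expR (- (m * x)) * x <= 2 by lra.
  by rewrite mulrCA mulrC ler_wpM2r.
have [h|h] := leP t 1.
  have -> : expR (- x) = expR (- ((t + (1 - t)) * x)) by congr (expR (- _)); ring.
  by rewrite distrC [`|t - 1|]distrC (@ger0_norm _ (1 - t)) ?subr_ge0 // distrC key ?subr_ge0.
have -> : expR (- (t * x)) = expR (- ((1 + (t - 1)) * x)) by congr (expR (- _)); ring.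
have -> : expR (- x) = expR (- (1 * x)) by congr (expR (- _)); ring.
by rewrite distrC (@ger0_norm _ (t - 1)) ?subr_ge0 ?(ltW h) // key ?subr_ge0 ?(ltW h) //; lra.
Qed.

End ExpLn.

(* The bound is halved on [p <= N / 2] by doubling, and transferred to
   [p > N / 2] by the reflection [p -> N - p]; the maximum of [`|c p|] is
   therefore controlled by itself with factor 1/2. *)
Lemma hyers_local (R : realType) (c : nat -> R) (N : nat) (D : R) :
  `|c N| <= D ->
  (forall p q, (p + q <= N)%N -> `|c (p + q)%N - (c p + c q)| <= D) ->
  forall p, (p <= N)%N -> `|c p| <= 5 * D.
Proof.
move=> cN cadd.
pose B := \big[Num.max/0]_(p < N.+1) `|c p|.
have cB p : (p <= N)%N -> `|c p| <= B.
  by rewrite -ltnS => hp; apply: (le_bigmax 0 (fun p : 'I_N.+1 => `|c p|) (Ordinal hp)).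
have D0 : 0 <= D by apply: le_trans cN.
have small p : (p + p <= N)%N -> `|c p| <= (B + D) / 2.
  move=> hp; have h1 := cB _ hp; have h2 := cadd _ _ hp.
  have : `|c p + c p| <= `|c (p + p)%N| + `|c (p + p)%N - (c p + c p)|.
    by rewrite -{1}(subKr (c (p + p)%N) (c p + c p)) ler_normB.
  by rewrite -mulr2n normrMn -mulr_natr; lra.
have B5 : B <= 5 * D.
  (* The constant 5 comes from solving this inequality for [B]. *)
  suff : B <= 2 * D + (B + D) / 2 by lra.
  apply: bigmax_le => [|[p /= hp] _].
    have : 0 <= B by apply: le_trans (cB 0%N isT).
    lra.
  rewrite ltnS in hp.
  have [h|h] := leqP (p + p) N; first by have := small p h; lra.
  have hq : (N - p + (N - p) <= N)%N by lia.
  have h1 := small _ hq.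
  have := cadd (N - p)%N p; rewrite subnK // => /(_ (leqnn N)) h2.
  rewrite (_ : c p = (c N - c (N - p)%N) - (c N - (c (N - p)%N + c p))); last by ring.
  apply: (le_trans (ler_normB _ _)); have := ler_normB (c N) (c (N - p)%N); lra.
by move=> p /cB/le_trans; apply.
Qed.

(** * Geometric decay of almost multiplicative sequences *)

Section Geometric.
Context {R : realType}.
Local Notation g := (expR (- 1) : R).

Lemma expRN1_lt_half : g < 2^-1.
Proof.
by rewrite expRN ltf_pV2 ?posrE ?expR_gt0 //; have := @expR_gt1Dx R 1 (oner_neq0 _); lra.
Qed.

(** Up to [N], [c n = ln (x n) + n / N] is additive up to [D] and nearly vanishes at [N], so
    [hyers_local] bounds it. Beyond [N], each further block of length [N] adds an error of at most
    [6 * D]. *)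
Lemma geometric_approx (x : nat -> R) (N T : nat) (e : R) :
  (0 < N)%N -> (0 < T)%N -> x 0%N = 1 -> (forall n, 0 <= x n) ->
  (forall m n, (m <= n)%N -> x n <= x m) ->
  x N <= g -> g <= x N.-1 -> 1 - x 1%N <= e -> e <= g / 4 ->
  (forall p q, (p + q <= T * N)%N -> `|x (p + q)%N - x p * x q| <= e) ->
  forall n, (n <= T * N)%N -> `|x n - expR (- (n%:R / N%:R))| <= T%:R * (24 * e / g ^+ 2).
Proof.
move=> N0 T0 x0 x_ge0 xanti xN xN1 x1 eg xmul.
have g0 : 0 < g := expR_gt0 _.
have glt := expRN1_lt_half.
have e0 : 0 <= e by apply: le_trans x1; rewrite subr_ge0 -x0 xanti.
have le1 n : x n <= 1 by rewrite -x0 xanti.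
have NT : (N <= T * N)%N by rewrite leq_pmull.
have NR : (0 : R) < N%:R by rewrite ltr0n.
(* The products [x p * x q] met below are at least [g ^+ 2 / 4], where [ln] has Lipschitz constant
   [4 / g ^+ 2]. *)
pose D := 4 * e / g ^+ 2.
have gg : 0 < g ^+ 2 by rewrite exprn_gt0.
have D3 : 4 * e / g <= D.
  rewrite /D ler_pdivlMr // expr2 mulrA divfK ?gt_eqF // ler_piMr //; lra.
have Dg : 4 * e <= D.
  apply: le_trans D3; rewrite ler_pdivlMr // ler_piMr //; lra.
have D0 : 0 <= D by lra.
(* Passing from [N.-1] to [N] loses at most [e] from the multiplicativity error and [e] from
   [1 - x 1]. *)
have xNclose : `|x N - g| <= 2 * e.
  rewrite ler_distl; apply/andP; split; last lra.
  have := xmul N.-1 1%N; rewrite addn1 prednK // => /(_ NT).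
  rewrite ler_distl => /andP[h _].
  have : x N.-1 * (1 - x 1%N) <= 1 * (1 - x 1%N) by rewrite ler_wpM2r // subr_ge0.
  lra.
have xNlow : g / 2 <= x N by move: xNclose; rewrite ler_distl => /andP[]; lra.
have xlow n : (n <= N)%N -> g / 2 <= x n by move=> h; apply: le_trans xNlow _; exact: xanti.
have xpos n : (n <= N)%N -> 0 < x n by move=> /xlow; apply: lt_le_trans; lra.
pose c n := ln (x n) + n%:R / N%:R.
have cN : `|c N| <= D.
  rewrite /c divff ?gt_eqF //.
  have -> : (1 : R) = - ln g by rewrite expRK; ring.
  apply: le_trans (ln_lipschitz (_ : 0 < g / 2) xNlow _) _; [lra|lra|].
  apply: le_trans D3; rewrite ler_pdivrMr; last lra.
  have -> : 4 * e / g * (g / 2) = 2 * e by field; rewrite gt_eqF.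
  exact: xNclose.
have cadd p q : (p + q <= N)%N -> `|c (p + q)%N - (c p + c q)| <= D.
  move=> pq; have hp : (p <= N)%N by apply: leq_trans pq; apply: leq_addr.
  have hq : (q <= N)%N by apply: leq_trans pq; apply: leq_addl.
  have -> : c (p + q)%N - (c p + c q) = ln (x (p + q)%N) - ln (x p * x q).
    by rewrite lnM ?posrE ?xpos // /c natrD mulrDl; ring.
  have h0 := xlow _ pq; have h1 := xlow _ hp; have h2 := xlow _ hq.
  have g4 : g ^+ 2 / 4 <= g / 2.
    rewrite expr2; have : g * g <= g * 2^-1 by rewrite ler_wpM2l; lra.
    lra.
  apply: le_trans (ln_lipschitz (_ : 0 < g ^+ 2 / 4) _ _) _.
  - lra.
  - lra.
  - have -> : g ^+ 2 / 4 = (g / 2) * (g / 2) by field.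
    by apply: ler_pM => //; lra.
  rewrite ler_pdivrMr; last lra.
  have -> : D * (g ^+ 2 / 4) = e by rewrite /D; field; rewrite gt_eqF.
  by apply: xmul; apply: leq_trans NT.
have base n : (n <= N)%N -> `|x n - expR (- (n%:R / N%:R))| <= 6 * D.
  move=> hn; rewrite -[x n]lnK ?posrE ?xpos //.
  apply: le_trans (expR_lipschitz_neg _ _) _.
  - exact: ln_le0.
  - by rewrite oppr_le0 divr_ge0.
  rewrite opprK; have := hyers_local cN cadd hn; rewrite /c; lra.
have -> : 24 * e / g ^+ 2 = 6 * D by rewrite /D; ring.
(* Induction on the number of blocks: [x n] is compared with [x (n - N) * x N], and [x N] with
   [g]. *)
elim: (T) T0 xmul NT => // t IH _ xmul NT n hn.
case: t IH xmul NT hn => [|t] IH xmul NT hn; first by rewrite mul1r base // -(mul1n N).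
have [h|h] := leqP n N.
  apply: (le_trans (base n h)); rewrite ler_peMl ?mulr_ge0 // ler1n //.
have hn' : (n - N <= t.+1 * N)%N by rewrite leq_subLR -mulSn.
have xm p q : (p + q <= t.+1 * N)%N -> `|x (p + q)%N - x p * x q| <= e.
  by move=> pq; apply: xmul; apply: leq_trans pq _; rewrite leq_mul2r leqnSn orbT.
have NT' : (N <= t.+1 * N)%N by rewrite leq_pmull.
have IHn := IH isT xm NT' _ hn'.
have := xmul (n - N)%N N; rewrite subnK ?(ltnW h) // => /(_ hn) mm.
have -> : expR (- (n%:R / N%:R)) = expR (- ((n - N)%:R / N%:R)) * g.
  rewrite -expRD; congr expR; rewrite natrB ?(ltnW h) //; field; rewrite gt_eqF //.
set y := expR _ in IHn *.
have y1 : `|y| <= 1.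
  by rewrite /y ger0_norm ?expR_ge0 // expR_le1 oppr_le0 divr_ge0.
have -> : x n - y * g = (x n - x (n - N)%N * x N) + ((x (n - N)%N - y) * x N + y * (x N - g)).
  by ring.
apply: le_trans (ler_normD _ _) _.
have := ler_normD ((x (n - N)%N - y) * x N) (y * (x N - g)).
rewrite !normrM.
have h1 : `|x (n - N)%N - y| * `|x N| <= `|x (n - N)%N - y| * 1.
  by rewrite ler_wpM2l // ger0_norm.
have h2 : `|y| * `|x N - g| <= 1 * `|x N - g| by rewrite ler_wpM2r.
have -> : t.+2%:R * (6 * D) = t.+1%:R * (6 * D) + 6 * D by rewrite -[t.+2%:R]natr1; ring.
lra.
Qed.

(** The sum is [(1 - g) / (1 - y)] with [y = exp (- 1 / N)], and [1 - y] lies between [1 / (N + 1)]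
    and [1 / N]. *)
Lemma geometric_sum_approx (N : nat) : (0 < N)%N ->
  `|\sum_(j < N) expR (- (j%:R / N%:R)) - N%:R * (1 - g)| <= 1.
Proof.
move=> N0; have NR : (0 : R) < N%:R by rewrite ltr0n.
pose y : R := expR (- N%:R^-1).
have -> : \sum_(j < N) expR (- (j%:R / N%:R)) = \sum_(j < N) y ^+ j.
  by apply: eq_bigr => j _; rewrite -expRM_natl mulrN.
have yN : y ^+ N = g by rewrite -expRM_natl mulrN divff ?gt_eqF.
have geo : (1 - y) * \sum_(j < N) y ^+ j = 1 - g.
  by have := subrX1 y N; rewrite yN -(opprB g) => ->; ring.
set Z := \sum_(j < N) _ in geo *.
have Z0 : 0 <= Z by apply: sumr_ge0 => j _; rewrite exprn_ge0 // expR_ge0.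
have g0 : 0 < g := expR_gt0 _.
have glt := expRN1_lt_half.
have y_lo : 1 - y <= N%:R^-1 by have := expR_ge1Dx (- N%:R^-1 : R); rewrite -/y; lra.
have y_up : N%:R^-1 <= (1 + N%:R^-1) * (1 - y).
  have := expR_ge1Dx (N%:R^-1 : R); have := expRxMexpNx_1 (N%:R^-1 : R); rewrite -/y => h1 h2.
  have : (1 + N%:R^-1) * y <= 1 by rewrite -[leRHS]h1 ler_wpM2r // expR_ge0.
  lra.
have lo : N%:R * (1 - g) <= Z.
  have : (1 - y) * Z <= N%:R^-1 * Z by rewrite ler_wpM2r.
  rewrite geo => h; rewrite mulrC -ler_pdivlMr //; lra.
have up : Z <= (N%:R + 1) * (1 - g).
  rewrite -geo.
  have : N%:R * (N%:R^-1 * Z) <= N%:R * ((1 + N%:R^-1) * (1 - y) * Z).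
    by apply: ler_wpM2l; [exact: ltW|exact: ler_wpM2r].
  have -> : N%:R * (N%:R^-1 * Z) = Z by field; rewrite gt_eqF.
  have -> : N%:R * ((1 + N%:R^-1) * (1 - y) * Z) = (N%:R + 1) * ((1 - y) * Z).
    by field; rewrite gt_eqF.
  by [].
rewrite ler_distl; apply/andP; split; lra.
Qed.

End Geometric.

(** * The phantom distribution function *)

Section PhantomConstruction.
Context (R : realType) (U : Type) (a : nat -> U -> R).
Local Notation g := (expR (- 1) : R).
Local Notation c := (1 - 2 * expR (- 1) : R).

(** For large [s], [- ln (saturation s)] is close to [c / s], so [s] close to [c * N] turns the
    [n]-th power into about [exp (- n / N)]. The constant [c] is the integral of [exp (- t) - 1/e]
    over [0, 1]. *)
Definition saturation (s : R) : R := s / (s + c).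

(* Partial sums of [S u]; the term [n = 0] is left out so that the phantom
   vanishes where [a 1 u <= 1/e]. *)
Definition excess (K : nat) (u : U) : R := \sum_(j < K) Num.max (a j.+1 u - g) 0.

(* [saturation (excess K u)] is nondecreasing in [K]; the supremum gives the
   value 1 where the sum of the series is infinite. *)
Definition phantom (u : U) : R := sup (range (fun K => saturation (excess K u))).

Let g0 : 0 < g. Proof. exact: expR_gt0. Qed.
Let c0 : 0 < c. Proof. by have := @expRN1_lt_half R; lra. Qed.
Let c1 : c < 1. Proof. by have := g0; lra. Qed.

Lemma saturationE s : 0 <= s -> saturation s = 1 - c / (s + c).
Proof. by move=> s0; rewrite /saturation; field; rewrite gt_eqF //; have := c0; lra. Qed.

Lemma saturation_ge0 s : 0 <= s -> 0 <= saturation s.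
Proof. by move=> s0; rewrite divr_ge0 // addr_ge0 // ltW. Qed.

Lemma saturation_le1 s : 0 <= s -> saturation s <= 1.
Proof. by move=> s0; rewrite ler_pdivrMr ?mul1r ?lerDl ?ltW // ltr_wpDl. Qed.

Lemma saturation_lt1 s : 0 <= s -> saturation s < 1.
Proof. by move=> s0; rewrite ltr_pdivrMr ?mul1r ?ltrDl // ltr_wpDl. Qed.

Lemma saturation_le s t : 0 <= s -> s <= t -> saturation s <= saturation t.
Proof.
move=> s0 st; have t0 := le_trans s0 st; rewrite !saturationE // lerD2l lerN2.
have sc : 0 < s + c by rewrite ltr_wpDl.
have tc : 0 < t + c by rewrite ltr_wpDl.
by apply: ler_wpM2l; rewrite ?(ltW c0) // lef_pV2 ?posrE // lerD2r.
Qed.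

Lemma saturation_cvg1 (e k : R) : 0 < e -> 0 < k ->
  exists K : nat, 1 - e <= saturation (K%:R * k).
Proof.
move=> e0 k0; exists (Num.truncn ((e * k)^-1)).+1.
set K := _.+1; have hK : (e * k)^-1 < K%:R by apply: truncnS_gt.
have Kk : 0 <= K%:R * k by rewrite mulr_ge0 // ltW.
have sc : 0 < K%:R * k + c by rewrite ltr_wpDl.
rewrite saturationE // lerD2l lerN2 ler_pdivrMr //.
have : 1 <= K%:R * (e * k) by rewrite -ler_pdivrMr ?mulr_gt0 // mul1r ltW.
have : 0 <= e * c by rewrite mulr_ge0 // ltW.
have := c1; lra.
Qed.

(** Both bounds are [1 + x <= exp x], with [x = - c / (s + c)] for the upper one and, as the inverse
    of [saturation s] is [1 + c / s], with [x = c / s] for the lower one. *)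
Lemma saturation_exp s n : 0 < s ->
  expR (- (c * n%:R / s)) <= saturation s ^+ n <= expR (- (c * n%:R / (s + c))).
Proof.
move=> s0; have sc : 0 < s + c by rewrite addr_gt0.
have s0' := ltW s0.
apply/andP; split.
  rewrite (_ : - (c * n%:R / s) = n%:R * - (c / s)); last by field; rewrite gt_eqF.
  rewrite expRM_natl lerXn2r ?nnegrE ?expR_ge0 ?saturation_ge0 //.
  rewrite expRN /saturation -[leRHS]invrK lef_pV2 ?posrE ?expR_gt0 ?invr_gt0 ?divr_gt0 //.
  rewrite invf_div mulrDl divff ?gt_eqF //; exact: expR_ge1Dx.
rewrite (_ : - (c * n%:R / (s + c)) = n%:R * - (c / (s + c))); last by field; rewrite gt_eqF.
rewrite expRM_natl lerXn2r ?nnegrE ?expR_ge0 ?saturation_ge0 // saturationE //.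
exact: expR_ge1Dx.
Qed.

Lemma excess_ge0 K u : 0 <= excess K u.
Proof. by apply: sumr_ge0 => j _; rewrite le_max lexx orbT. Qed.

Lemma excess_le K L u : (K <= L)%N -> excess K u <= excess L u.
Proof.
move=> KL; rewrite /excess -(subnKC KL) big_split_ord /= lerDl.
by apply: sumr_ge0 => j _; rewrite le_max lexx orbT.
Qed.

Lemma phantom_has_sup u : has_sup (range (fun K => saturation (excess K u))).
Proof.
split; first by exists (saturation (excess 0 u)), 0%N.
by exists 1 => _ [K _ <-]; rewrite saturation_le1 // excess_ge0.
Qed.

Lemma phantom_ge u K : saturation (excess K u) <= phantom u.
Proof. by apply: ub_le_sup; [have [] := phantom_has_sup u|exists K]. Qed.

Lemma phantom_le u x : (forall K, saturation (excess K u) <= x) -> phantom u <= x.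
Proof.
move=> h; apply: ge_sup; first by have [] := phantom_has_sup u.
by move=> _ [K _ <-].
Qed.

Lemma phantom_le1 u : phantom u <= 1.
Proof. by apply: phantom_le => K; rewrite saturation_le1 // excess_ge0. Qed.

Lemma phantom_ge0 u : 0 <= phantom u.
Proof. by apply: le_trans (phantom_ge u 0); rewrite saturation_ge0 // excess_ge0. Qed.

Context (a0 : forall u, a 0 u = 1) (a_ge0 : forall n u, 0 <= a n u)
  (a_anti : forall u m n, (m <= n)%N -> a n u <= a m u)
  (a_drop : forall u q r, a q u - a (q + r)%N u <= 1 - a r u)
  (a_mix : forall e : R, 0 < e ->
     exists r0, forall r, (r0 <= r)%N -> mixing_at a r e).

Lemma excess_stationary K L u : (K <= L)%N -> a K.+1 u <= g -> excess L u = excess K u.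
Proof.
move=> KL hK; rewrite /excess -(subnKC KL) big_split_ord /= [X in _ + X]big1 ?addr0 // => j _.
by apply/max_idPr; rewrite subr_le0; apply: le_trans hK; apply: a_anti; rewrite ltnS leq_addr.
Qed.

(** The terms after the first [K] vanish, so the supremum is attained at [K] and only a finite sum
    is involved. *)
Lemma phantomE K u : a K.+1 u <= g -> phantom u = saturation (excess K u).
Proof.
move=> hK; apply/eqP; rewrite eq_le phantom_ge andbT; apply: phantom_le => L.
have [LK|/ltnW KL] := leqP L K; last by rewrite (excess_stationary KL).
by apply: saturation_le; [exact: excess_ge0|exact: excess_le].
Qed.

(** Each of the first [K] terms is at least [(1 - g) / 2]. As [K] depends on [e] only, this yields
    continuity where the phantom is 1 and its limit at +oo. *)
Lemma phantom_near1 (e : R) : 0 < e ->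
  exists K, forall u, (1 + g) / 2 <= a K u -> 1 - e <= phantom u.
Proof.
move=> e0; have := @expRN1_lt_half R => glt.
have [K hK] := @saturation_cvg1 e ((1 - g) / 2) e0 ltac:(lra).
exists K => u hu; apply: (le_trans hK); apply: le_trans (phantom_ge u K).
apply: saturation_le; first by rewrite mulr_ge0 //; lra.
rewrite mulr_natl -[X in _ *+ X]card_ord -sumr_const.
apply: ler_sum => j _; rewrite le_max; apply/orP; left.
have := a_anti u (ltn_ord j); lra.
Qed.

(** [geometric_approx] covers [n <= T * N]; [T] is so large that beyond this range both terms are at
    most [e] by monotonicity. *)
Lemma geometric_decay (e : R) : 0 < e ->
  exists N0, forall N u, (N0 <= N)%N -> a N u <= g -> g <= a N.-1 u ->
    forall n, `|a n u - expR (- (n%:R / N%:R))| <= e.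
Proof.
move=> e0; have glt := @expRN1_lt_half R; have gpos := g0.
have [T' hT'] := @exists_expr_le R g (e / 2) ltac:(lra) ltac:(lra) ltac:(lra).
pose T := T'.+1.
have hT : g ^+ T <= e / 2.
  by apply: le_trans hT'; rewrite exprS ler_piMl ?exprn_ge0 //; lra.
have gg : 0 < g ^+ 2 by rewrite exprn_gt0.
have TR : 0 < T%:R :> R by rewrite ltr0n.
pose e' := Num.min (g / 4) (e * g ^+ 2 / (48 * T%:R)).
have e'0 : 0 < e' by rewrite lt_min !divr_gt0 ?mulr_gt0 //=.
have e'g : e' <= g / 4 by rewrite ge_min lexx.
have e'e : T%:R * (24 * e' / g ^+ 2) <= e / 2.
  have : e' <= e * g ^+ 2 / (48 * T%:R) by rewrite ge_min lexx orbT.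
  rewrite ler_pdivlMr ?mulr_gt0 // => h.
  by rewrite mulrA ler_pdivrMr //; lra.
(* The lower bound [g] is available at [N.-1], not at [N]; the factor 2 makes [2 * T * N.-1] at
   least [T * N]. *)
have [N0 qm] := @approximately_multiplicative R U a a0 a_ge0 a_anti a_drop a_mix
  g e' (2 * T) g0 e'0 ltac:(lra) isT.
exists N0.+2 => N u hN aN aN1 n.
case: N hN aN aN1 => // N hN aN aN1.
have [h1 h2] := qm N u (ltnW hN) aN1.
have approx : forall n, (n <= T * N.+1)%N -> `|a n u - expR (- (n%:R / N.+1%:R))| <= e / 2.
  move=> m hm; apply: le_trans e'e; apply: (geometric_approx (x := a ^~ u)) hm => //.
    by move=> p q; exact: a_anti.
  move=> p q pq; apply: h2; apply: leq_trans pq _.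
  by clear -hN; rewrite -mulnA mulnCA leq_mul2l; apply/orP; right; lia.
have [h|h] := leqP n (T * N.+1); first by apply: le_trans (approx n h) _; lra.
have NR : 0 < N.+1%:R :> R by rewrite ltr0n.
have y_le : expR (- (n%:R / N.+1%:R)) <= g ^+ T.
  have <- : expR (- T%:R) = g ^+ T :> R by rewrite -expRM_natl mulrN1.
  rewrite ler_expR lerN2 ler_pdivlMr // -natrM ler_nat ltnW //.
have gT : expR (- T%:R) = g ^+ T :> R by rewrite -expRM_natl mulrN1.
have := approx _ (leqnn _); rewrite natrM mulfK ?gt_eqF // gT ler_distl => /andP[_ h3].
have h4 := a_anti u (ltnW h).
rewrite ler_distl; apply/andP; split.
  by have := a_ge0 n u; lra.
by have := expR_ge0 (- (n%:R / N.+1%:R) : R); lra.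
Qed.

(** By [geometric_decay] the sum of the [a j u] is close to [N.+1 * (1 - g)]; subtracting [g] from
    each of the [N.+1] terms leaves [N.+1 * c]. *)
Lemma excess_equiv (e : R) : 0 < e ->
  exists N0, forall N u, (N0 <= N)%N -> a N.+1 u <= g -> g <= a N u ->
    `|excess N u - N.+1%:R * c| <= N.+1%:R * e.
Proof.
move=> e0; have [N0 geo] := geometric_decay (ltac:(lra) : 0 < e / 2).
exists (maxn N0 (Num.truncn (4 / e)).+1) => N u hN aN1 aN.
move: hN; rewrite geq_max => /andP[hN0 hN].
have NR : 0 < N.+1%:R :> R by rewrite ltr0n.
have Ne : 4 <= N.+1%:R * e.
  rewrite -ler_pdivrMr //; apply/ltW; apply: lt_le_trans (truncnS_gt _) _.
  by rewrite ler_nat; apply: leqW.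
(* Restoring the term [j = 0] costs [1 - g]; with the error of the geometric sum this is at most 2,
   hence the threshold [4 / e]. *)
have -> : excess N u = \sum_(j < N.+1) (a j u - g) - (1 - g).
  rewrite big_ord_recl /= a0 addrC addKr; apply: eq_bigr => j _; apply/max_idPl.
  by rewrite subr_ge0; apply: le_trans aN _; apply: a_anti.
have := @geometric_sum_approx R N.+1 isT.
set Z := \sum_(j < N.+1) _ => hZ.
have hS : `|\sum_(j < N.+1) a j u - Z| <= N.+1%:R * (e / 2).
  rewrite /Z -sumrB; apply: le_trans (ler_norm_sum _ _ _) _.
  have -> : N.+1%:R * (e / 2) = \sum_(j < N.+1) (e / 2) by rewrite sumr_const card_ord mulr_natl.
  apply: ler_sum => j _; by apply: geo => //; exact: leqW.
rewrite sumrB sumr_const card_ord -mulr_natl.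
have := g0; have := @expRN1_lt_half R.
move: hS hZ; rewrite !ler_distl => /andP[? ?] /andP[? ?] ? ?.
by apply/andP; split; lra.
Qed.

(** With [s] the excess, [saturation_exp] encloses [phantom u ^+ n] between exponentials of rates
    [c / s] and [c / (s + c)]. Both rates are [1 / N] up to a factor close to 1, and
    [expRN_scale_close] makes the error uniform in [n]. *)
Lemma phantom_approx (e : R) : 0 < e ->
  exists N0, forall N u, (N0 <= N)%N -> a N u <= g -> g <= a N.-1 u ->
    forall n, `|a n u - phantom u ^+ n| <= e.
Proof.
move=> e0; have cpos := c0.
(* The first bound keeps [s] above half of [N * c]; the second makes the final error [8 * d / c] at
   most [e / 2]. *)
pose d := Num.min (c / 8) (e * c / 16).
have d0 : 0 < d by rewrite lt_min !divr_gt0 ?mulr_gt0.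
have dc : d <= c / 8 by rewrite ge_min lexx.
have de : d <= e * c / 16 by rewrite ge_min lexx orbT.
have [N0 geo] := geometric_decay (ltac:(lra) : 0 < e / 2).
have [N1 exc] := excess_equiv d0.
exists (maxn (maxn N0 N1) (Num.truncn (1 / d)).+1).+1 => N u hN aN aN1 n.
have {}geo := geo N u (leq_trans (leq_trans (leq_maxl _ _) (leq_maxl _ _)) (ltnW hN)) aN aN1 n.
case: N hN aN aN1 geo => // N; rewrite ltnS !geq_max -andbA => /and3P[hN0 hN1 hN] aN aN1 geo.
have NR : 0 < N.+1%:R :> R by rewrite ltr0n.
have Nd : 1 <= N.+1%:R * d.
  rewrite -ler_pdivrMr //; apply/ltW; apply: lt_le_trans (truncnS_gt _) _.
  by rewrite ler_nat; apply: leqW.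
have {}exc := exc N u hN1 aN aN1.
rewrite (phantomE aN).
set s := excess N u in exc *.
move: exc; rewrite ler_distl => /andP[s_lo s_up].
have Nc : N.+1%:R * d <= N.+1%:R * (c / 8) by rewrite ler_wpM2l // ltW.
have s0 : N.+1%:R * (c / 2) <= s by lra.
have spos : 0 < s by apply: lt_le_trans s0; rewrite !mulr_gt0 // divr_gt0.
set x := n%:R / N.+1%:R in geo *.
have x0 : 0 <= x by rewrite divr_ge0.
have close v : `|v - N.+1%:R * c| <= 2 * (N.+1%:R * d) -> N.+1%:R * (c / 2) <= v ->
    `|expR (- (c * n%:R / v)) - expR (- x)| <= e / 2.
  move=> hv vlo; have vpos : 0 < v by apply: lt_le_trans vlo; rewrite !mulr_gt0 // divr_gt0.
  have -> : c * n%:R / v = (N.+1%:R * c / v) * x by rewrite /x; field; rewrite !gt_eqF.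
  apply: (le_trans (expRN_scale_close x0 _)).
    rewrite ler_pdivlMr //; move: hv; rewrite ler_distl => /andP[]; lra.
  have -> : N.+1%:R * c / v - 1 = (N.+1%:R * c - v) / v by field; rewrite gt_eqF.
  rewrite normrM normfV (gtr0_norm vpos) mulrA ler_pdivrMr // distrC.
  have h1 : N.+1%:R * d <= N.+1%:R * (e * c / 16) by rewrite ler_wpM2l // ltW.
  have h2 : e / 2 * (N.+1%:R * (c / 2)) <= e / 2 * v by rewrite ler_wpM2l //; lra.
  lra.
have /andP[lo up] := saturation_exp n spos.
have cs : `|s - N.+1%:R * c| <= 2 * (N.+1%:R * d).
  by rewrite ler_distl; apply/andP; split; lra.
have csc : `|(s + c) - N.+1%:R * c| <= 2 * (N.+1%:R * d).
  by have := c1; rewrite ler_distl => ?; apply/andP; split; lra.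
have := close s cs s0; have := close (s + c) csc ltac:(lra); move: geo.
rewrite !ler_distl => /andP[? ?] /andP[? ?] /andP[? ?]; apply/andP; split; lra.
Qed.

(** If [a 1 u] were below 1, [eventually_small] would bring some [a n u] down to [g]; hence
    [a 1 u = 1], and [a_drop] spreads this to all [n]. *)
Lemma phantom_eq1 u : (forall K, g < a K u) -> phantom u = 1 /\ forall n, a n u = 1.
Proof.
move=> h.
have a1 : a 1 u = 1.
  apply/eqP; rewrite eq_le -{1}(a0 u) a_anti //= leNgt; apply/negP => lt1.
  have [n0 /(_ n0 u (leqnn _) (lexx _))] :=
    eventually_small a0 a_ge0 a_anti a_mix 1 (a_ge0 1 u) lt1 g0.
  by rewrite leNgt h.
have an n : a n u = 1.
  elim: n => [|n IH]; first exact: a0.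
  apply/eqP; rewrite eq_le -{1}(a0 u) a_anti //=.
  by have := a_drop u n 1; rewrite a1 IH addn1; lra.
split=> //; apply/eqP; rewrite eq_le phantom_le1 /=.
apply/ler_addgt0Pl => e e0; rewrite addrC -lerBlDr.
have [K hK] := phantom_near1 e0.
by apply: hK; rewrite an; have := @expRN1_lt_half R; lra.
Qed.

(** Let [N] be the first index with [a N u <= g]. For large [N], [phantom_approx] applies; for
    [N < N0], both terms are small, as [phantom u] is at most a constant below 1; if there is no
    such [N], both terms are 1. *)
Lemma phantom_uniform (e : R) : 0 < e ->
  exists n0, forall n u, (n0 <= n)%N -> `|a n u - phantom u ^+ n| <= e.
Proof.
move=> e0; have glt := @expRN1_lt_half R; have gpos := g0.
have [N0 approx] := phantom_approx e0.
have [n0 vanish] := @eventually_small R U a a0 a_ge0 a_anti a_mix N0 g e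
  ltac:(lra) ltac:(lra) e0.
have [n1 hn1] := exists_expr_le (saturation_ge0 (ler0n R N0)) (saturation_lt1 (ler0n R N0)) e0.
exists (maxn n0 n1) => n u; rewrite geq_max => /andP[hn0 hn1'].
have [[K hK]|h] := pselect (exists K, a K u <= g); last first.
  have [|-> an] := @phantom_eq1 u.
    by move=> K; rewrite ltNge; apply/negP => hK; apply: h; exists K.
  by rewrite an expr1n subrr normr0 ltW.
have exK : exists K, a K u <= g by exists K.
case: (ex_minnP exK) => N aN Nmin.
have [hN|hN] := leqP N0 N.
  apply: (approx N) => //.
  case: N aN Nmin hN => [|N] aN Nmin hN; first by move: aN; rewrite a0; lra.
  by rewrite leNgt /=; apply/negP => /ltW/Nmin; rewrite ltnn.
have aN0 : a N0 u <= g by apply: le_trans aN; apply: a_anti; exact: ltnW.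
have an := vanish n u hn0 aN0.
have pn : phantom u ^+ n <= e.
  have ph : phantom u <= saturation N0%:R.
    rewrite (@phantomE N0); last by apply: le_trans aN0; apply: a_anti.
    apply: saturation_le; first exact: excess_ge0.
    have -> : N0%:R = \sum_(j < N0) (1 : R) by rewrite sumr_const card_ord.
    apply: ler_sum => j _.
    rewrite ge_max ler01 andbT; have := a_anti u (leq0n j.+1); rewrite a0; lra.
  apply: le_trans hn1; apply: (le_trans (y := saturation N0%:R ^+ n)).
    by rewrite lerXn2r ?nnegrE ?phantom_ge0 ?saturation_ge0.
  by apply: ler_wiXn2l => //; [exact: saturation_ge0|exact: saturation_le1].
rewrite ler_distl; have := a_ge0 n u; have := exprn_ge0 n (phantom_ge0 u).
by move=> ? ?; apply/andP; split; lra.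
Qed.

End PhantomConstruction.

(** * Monotonicity, continuity and limits of the phantom *)

Section PhantomOnTheLine.
Context (R : realType) (a : nat -> R -> R).
Context (a0 : forall u, a 0 u = 1) (a_ge0 : forall n u, 0 <= a n u)
  (a_anti : forall u m n, (m <= n)%N -> a n u <= a m u)
  (a_drop : forall u q r, a q u - a (q + r)%N u <= 1 - a r u)
  (a_mix : forall e : R, 0 < e ->
     exists r0, forall r, (r0 <= r)%N -> mixing_at a r e)
  (a_homo : forall n u v, u <= v -> a n u <= a n v)
  (a_cont : forall n, continuous (a n))
  (a_Ny : a 1 @ -oo --> (0 : R))
  (a_y : forall n, a n @ +oo --> (1 : R)).
Local Notation g := (expR (- 1) : R).
Local Notation G := (phantom a).

Lemma phantom_homo : {homo G : u v / u <= v}.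
Proof.
move=> u v uv; apply: phantom_le => K; apply: le_trans (phantom_ge a v K).
apply: saturation_le; first exact: excess_ge0.
apply: ler_sum => j _; rewrite ge_max !le_max lexx orbT andbT lerD2r.
by rewrite a_homo.
Qed.

Lemma continuous_saturation (s : R) : 0 <= s -> {for s, continuous (@saturation R)}.
Proof.
move=> s0; have := @expRN1_lt_half R => glt.
apply: cvgM; first exact: cvg_id.
apply: cvgV; first by rewrite gt_eqF //; lra.
by apply: cvgD; [exact: cvg_id|exact: cvg_cst].
Qed.

Lemma continuous_excess K : continuous (excess a K).
Proof.
move=> u; apply: cvg_big => [|j _]; first exact: add_continuous.
apply: (@continuous_max _ _ (fun v => a j.+1 v - g) (cst 0)); last exact: cvg_cst.
by apply: cvgB; [exact: a_cont|exact: cvg_cst].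
Qed.

(** If [a K u <= g] for some [K], a later [a n u] is strictly below [g] and stays so near [u], where
    the phantom is then the saturation of a fixed finite sum. Otherwise its value at [u] is 1 and
    [phantom_near1] applies nearby. *)
Lemma phantom_continuous : continuous G.
Proof.
move=> u; have := @expRN1_lt_half R => glt; have gpos : 0 < g := expR_gt0 _.
have [[K hK]|h] := pselect (exists K, a K u <= g).
  have [n0 vanish] := @eventually_small R R a a0 a_ge0 a_anti a_mix K g (g / 2)
    ltac:(lra) ltac:(lra) ltac:(lra).
  have an := vanish n0.+1 u (leqnSn _) hK.
  have near_le : \forall v \near u, a n0.+1 v <= g.
    have : \forall v \near u, a n0.+1 v < g.
      apply: (cvgr_lt _ (@a_cont n0.+1 u)); lra.
    by apply: filterS => v /ltW.
  have : {near u, (fun v => saturation (excess a n0 v)) =1 G}.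
    by near=> v; rewrite (phantomE a_anti (K := n0)) //; near: v.
  move=> /near_eq_cvg H.
  rewrite /continuous_at (phantomE a_anti (K := n0)); last by lra.
  apply: cvg_trans H _.
  apply: continuous_comp; first exact: continuous_excess.
  by apply: continuous_saturation; apply: excess_ge0.
have [|Gu an] := @phantom_eq1 R R a a0 a_ge0 a_anti a_drop a_mix u.
  by move=> K; rewrite ltNge; apply/negP => hK; apply: h; exists K.
apply/cvgrPdist_le => e e0; rewrite Gu.
have [K hK] := phantom_near1 a_anti e0.
have : \forall v \near u, (1 + g) / 2 < a K v.
  by apply: (cvgr_gt _ (@a_cont K u)); rewrite an; lra.
apply: filterS => v /ltW/hK h1; have := phantom_le1 a v.
by rewrite ler_distl => ?; apply/andP; split; lra.
Unshelve. all: by end_near.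
Qed.

Lemma phantom_cvgNy : G @ -oo --> (0 : R).
Proof.
have gpos : 0 < g := expR_gt0 _.
apply/cvgrPdist_le => e e0.
have : \forall v \near -oo, a 1 v < g by exact: (cvgr_lt _ a_Ny _ gpos).
apply: filterS => v /ltW /(phantomE a_anti) ->.
by rewrite /excess big_ord0 /saturation mul0r subrr normr0 ltW.
Qed.

Lemma phantom_cvgy : G @ +oo --> (1 : R).
Proof.
have := @expRN1_lt_half R => glt.
apply/cvgrPdist_le => e e0.
have [K hK] := phantom_near1 a_anti e0.
have : \forall v \near +oo, (1 + g) / 2 < a K v.
  by apply: (cvgr_gt _ (a_y K)); lra.
apply: filterS => v /ltW/hK h1; have := phantom_le1 a v.
by rewrite ler_distl => ?; apply/andP; split; lra.
Qed.

Lemma phantom_exists : exists H : cumulativeBounded (0 : R) (1 : R),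
  continuous H /\ forall e : R, 0 < e ->
    exists n0, forall n u, (n0 <= n)%N -> `|a n u - H u ^+ n| <= e.
Proof.
have rc : right_continuous G.
  by move=> u; apply: cvg_within_filter; exact: phantom_continuous.
pose isC := isCumulative.Build R _ R G phantom_homo rc.
pose isB := isCumulativeBounded.Build R 0 1 G phantom_cvgNy phantom_cvgy.
pose H : cumulativeBounded (0 : R) (1 : R) := HB.pack G isC isB.
exists H; split; first exact: phantom_continuous.
by move=> e e0; have [n0 h] := phantom_uniform a0 a_ge0 a_anti a_drop a_mix e0; exists n0.
Qed.

End PhantomOnTheLine.

(** * Joint distributions and weak dependence *)

Section BoundedRandomVariables.
Context (d : measure_display) (T : measurableType d) (R : realType) (P : probability T R).
Implicit Types f h : T -> R.

Definition bounded_rv (f : T -> R) : Prop :=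
  measurable_fun [set: T] f /\ exists M, forall w, `|f w| <= M.

Lemma bounded_rv_integrable f : bounded_rv f -> P.-integrable [set: T] (EFin \o f).
Proof.
move=> [mf [M fM]]; apply: measurable_bounded_integrable => //.
  by rewrite (le_lt_trans (probability_le1 P _)) ?ltry.
exists M; split; first exact: num_real.
by move=> y My w _; apply: le_trans (fM w) (ltW My).
Qed.

Lemma bounded_rv_cst (k : R) : bounded_rv (fun=> k).
Proof. by split; [exact: measurable_cst|exists `|k|]. Qed.

Lemma bounded_rvD f h : bounded_rv f -> bounded_rv h -> bounded_rv (fun w => f w + h w).
Proof.
move=> [mf [M fM]] [mh [N hN]]; split; first exact: measurable_funD.
by exists (M + N) => w; apply: le_trans (ler_normD _ _) _; rewrite lerD.
Qed.

Lemma bounded_rvB f h : bounded_rv f -> bounded_rv h -> bounded_rv (fun w => f w - h w).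
Proof.
move=> [mf [M fM]] [mh [N hN]]; split; first exact: measurable_funB.
by exists (M + N) => w; apply: le_trans (ler_normB _ _) _; rewrite lerD.
Qed.

Lemma bounded_rvM f h : bounded_rv f -> bounded_rv h -> bounded_rv (fun w => f w * h w).
Proof.
move=> [mf [M fM]] [mh [N hN]]; split; first exact: measurable_funM.
by exists (M * N) => w; rewrite normrM ler_pM.
Qed.

Definition mean f : R := \int[P]_w f w.

Lemma mean_cst (k : R) : mean (fun=> k) = k.
Proof. by rewrite /mean Rintegral_cst // [X in fine X](probability_setT P) mulr1. Qed.

Lemma meanD f h : bounded_rv f -> bounded_rv h -> mean (fun w => f w + h w) = mean f + mean h.
Proof. by move=> bf bh; apply: RintegralD => //; exact: bounded_rv_integrable. Qed.

Lemma meanB f h : bounded_rv f -> bounded_rv h -> mean (fun w => f w - h w) = mean f - mean h.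
Proof. by move=> bf bh; apply: RintegralB => //; exact: bounded_rv_integrable. Qed.

Lemma mean_le f h : bounded_rv f -> bounded_rv h -> (forall w, f w <= h w) -> mean f <= mean h.
Proof. by move=> bf bh fh; apply: le_Rintegral => //; exact: bounded_rv_integrable. Qed.

Lemma expectation_mean f : bounded_rv f -> ('E_P[f] = (mean f)%:E)%E.
Proof.
move=> bf; rewrite unlock /mean /Rintegral fineK //.
by apply: integrable_fin_num => //; exact: bounded_rv_integrable.
Qed.

Lemma covariance_mean f h : bounded_rv f -> bounded_rv h ->
  covariance P f h = (mean (fun w => f w * h w)%R - mean f * mean h)%:E.
Proof.
move=> bf bh; have bfh := bounded_rvM bf bh.
rewrite covarianceE; try by apply/Lfun1_integrable; exact: bounded_rv_integrable.
by rewrite !expectation_mean.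
Qed.

End BoundedRandomVariables.

(** * Joint distribution functions on the diagonal *)

Section JointDistribution.
Context (d : measure_display) (T : measurableType d) (R : realType) (P : probability T R).
Context (X : nat -> {RV P >-> R}).
Implicit Types (s t : seq nat) (u v : R) (w : T).

Definition below s u w : R := (all (fun j => X j w <= u) s)%:R.

Lemma below_cons j s u w : below (j :: s) u w = below [:: j] u w * below s u w.
Proof. by rewrite /below /= andbT -natrM mulnb. Qed.

Lemma below_cat s t u w : below (s ++ t) u w = below s u w * below t u w.
Proof. by rewrite /below all_cat -natrM mulnb. Qed.

Lemma below_ge0 s u w : 0 <= below s u w. Proof. exact: ler0n. Qed.

Lemma below_le1 s u w : below s u w <= 1. Proof. by rewrite /below; case: all. Qed.

Lemma below_homo s u v w : u <= v -> below s u w <= below s v w.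
Proof.
move=> uv; rewrite ler_nat; apply: (@leq_trans (all (fun j => X j w <= u) s)) => //.
by case: allP => // h; rewrite (introT allP) // => j /h hj; apply: le_trans hj uv.
Qed.

Lemma below_anti s t u w : {subset s <= t} -> below t u w <= below s u w.
Proof.
move=> st; rewrite ler_nat.
by case: (@allP _ _ t) => // h; rewrite (introT allP) // => j /st/h.
Qed.

Lemma below_indic s u : below s u = \1_[set w | all (fun j => X j w <= u) s].
Proof.
apply/funext => w; rewrite indicE /below; congr (_ %:R); congr nat_of_bool.
by apply/idP/idP; rewrite inE.
Qed.

Lemma measurable_below_event s u : measurable [set w | all (fun j => X j w <= u) s].
Proof.
elim: s => [|j s IH]; first by rewrite (_ : mkset _ = setT) //; apply/seteqP; split.
have -> : [set w | all (fun j => X j w <= u) (j :: s)] =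
    X j @^-1` `]-oo, u] `&` [set w | all (fun j => X j w <= u) s].
  by apply/seteqP; split=> w /=; rewrite in_itv /=; [move/andP|move=> [-> ->]].
by apply: measurableI => //; rewrite -[X in measurable X]setTI; apply: measurable_funP.
Qed.

Lemma bounded_below s u : bounded_rv (below s u).
Proof.
split; first by rewrite below_indic; apply: measurable_indic; exact: measurable_below_event.
by exists 1 => w; rewrite ger0_norm ?below_ge0 ?below_le1.
Qed.

Definition joint s u : R := mean P (below s u).

Lemma jointE s u : joint s u = fine (P [set w | all (fun j => X j w <= u) s]).
Proof.
rewrite /joint /mean /Rintegral below_indic integral_indic ?setIT //.
exact: measurable_below_event.
Qed.

Lemma joint_nil u : joint [::] u = 1.
Proof. exact: mean_cst. Qed.

Lemma joint_ge0 s u : 0 <= joint s u.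
Proof. by apply: Rintegral_ge0 => w _; exact: below_ge0. Qed.

Lemma joint_le1 s u : joint s u <= 1.
Proof.
rewrite -(mean_cst P 1); apply: mean_le; [exact: bounded_below|exact: bounded_rv_cst|].
exact: below_le1.
Qed.

Lemma joint_homo s u v : u <= v -> joint s u <= joint s v.
Proof.
by move=> uv; apply: mean_le => [||w];
  [exact: bounded_below|exact: bounded_below|exact: below_homo].
Qed.

Lemma joint_anti s t u : {subset s <= t} -> joint t u <= joint s u.
Proof.
by move=> st; apply: mean_le => [||w];
  [exact: bounded_below|exact: bounded_below|exact: below_anti].
Qed.

(** The left side is the probability that [s] stays below [u] while [t] does not. *)
Lemma joint_drop s t u : joint s u - joint (s ++ t) u <= 1 - joint t u.
Proof.
rewrite -(mean_cst P 1) /joint -!meanB;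
  do ?[exact: bounded_below|exact: bounded_rv_cst].
apply: mean_le; do ?[apply: bounded_rvB|exact: bounded_below|exact: bounded_rv_cst].
move=> w; rewrite below_cat -{1}[below s u w]mulr1 -mulrBr ler_piMl ?below_le1 //.
by rewrite subr_ge0 below_le1.
Qed.

(** Gives the lower half of [mixing_at], with [m] filling the gap; moving [m] to the end is
    harmless, as [joint] depends only on the set of indices. *)
Lemma joint_insert s m t u : joint (s ++ t) u - (1 - joint m u) <= joint (s ++ m ++ t) u.
Proof.
have := joint_drop (s ++ t) m u.
have -> : joint ((s ++ t) ++ m) u = joint (s ++ m ++ t) u; last by lra.
apply/eqP; rewrite eq_le; apply/andP; split; apply: joint_anti => j; rewrite !mem_cat.
  by case/or3P => ->; rewrite ?orbT.
by rewrite -orbA => /or3P[] ->; rewrite ?orbT.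
Qed.

(** Pointwise, the increment of a product of indicators is at most the sum of the increments of its
    factors. *)
Lemma joint_increment s u v : u <= v ->
  joint s v - joint s u <= \sum_(j <- s) (joint [:: j] v - joint [:: j] u).
Proof.
move=> uv; elim: s => [|j s IH]; first by rewrite big_nil !joint_nil subrr.
rewrite big_cons; apply: le_trans (lerD (lexx _) IH).
rewrite /joint -!meanB; do ?exact: bounded_below.
rewrite -meanD; do ?[apply: bounded_rvB|exact: bounded_below].
apply: mean_le; do ?[apply: bounded_rvB|apply: bounded_rvD|exact: bounded_below].
move=> w; rewrite !(below_cons j s).
have := below_homo [:: j] w uv; have := below_homo s w uv.
have := below_le1 [:: j] v w; have := below_ge0 [:: j] u w.
have := below_le1 s v w; have := below_ge0 s u w.
set x := below [:: j] v w; set y := below [:: j] u w.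
set x' := below s v w; set y' := below s u w.
move=> h1 h2 h3 h4 h5 h6.
have : (x - y) * x' <= x - y by rewrite ler_piMr // subr_ge0.
have : y * (x' - y') <= x' - y' by rewrite ler_piMl ?subr_ge0 //; lra.
lra.
Qed.

Lemma joint1 u : joint [:: 0%N] u = fine (cdf (X 0%N) u).
Proof.
rewrite jointE /cdf /distribution /pushforward; congr (fine (P _)).
by apply/seteqP; split=> w /=; rewrite in_itv /= andbT.
Qed.

(** Vanishes exactly on the orthant of points with all coordinates at most [u], and is 1-Lipschitz
    for [l1dist]. *)
Definition overshoot n u (x : n.-tuple R) : R := \sum_(k < n) Num.max (tnth x k - u) 0.

Lemma measurable_overshoot n u : measurable_fun [set: n.-tuple R] (@overshoot n u).
Proof.
apply: measurable_sum => k.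
apply: (@measurable_maxr _ _ R setT (fun x : n.-tuple R => tnth x k - u) (cst 0)) => //.
by apply: measurable_funB => //; exact: measurable_tnth.
Qed.

Lemma overshoot_ge0 n u (x : n.-tuple R) : 0 <= overshoot u x.
Proof. by apply: sumr_ge0 => k _; rewrite le_max lexx orbT. Qed.

Lemma overshoot_eq0 n u (x : n.-tuple R) : (overshoot u x == 0) = all (fun y => y <= u) x.
Proof.
rewrite /overshoot psumr_eq0; last by move=> k _; rewrite le_max lexx orbT.
apply/allP/all_tnthP => h k; last by move=> _ /=; apply/eqP/max_idPr; rewrite subr_le0.
have /= /eqP/max_idPr := h k (mem_index_enum _); by rewrite subr_le0.
Qed.

Context (X_stationary : strictly_stationary X).

Lemma joint_shift h s u : joint (map (addn h) s) u = joint s u.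
Proof.
(* The orthant is measurable as the zero set of [overshoot], so stationarity applies to it. *)
have mA n : measurable [set x : n.-tuple R | all (fun y => y <= u) x].
  have -> : [set x : n.-tuple R | all (fun y => y <= u) x] =
      setT `&` (@overshoot n u) @^-1` [set 0].
    by rewrite setTI; apply/seteqP; split=> x /=; rewrite -overshoot_eq0 => /eqP.
  exact: measurable_overshoot.
have pre n (k : n.-tuple nat) : [set w | all (fun j => X j w <= u) k] =
    vec X k @^-1` [set x : n.-tuple R | all (fun y => y <= u) x].
  by apply/seteqP; split=> w /=; rewrite all_map.
by rewrite !jointE (pre _ [tuple of map (addn h) (in_tuple s)]) (pre _ (in_tuple s)) X_stationary.
Qed.

Lemma joint_iota h n u : joint (iota h n) u = joint (iota 0 n) u.
Proof. by rewrite -{1}[h]addn0 iotaDl joint_shift. Qed.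

(** By stationarity every index contributes the same increment; the regularity of the marginal
    enters through this bound. *)
Lemma joint_modulus s u v : u <= v ->
  joint s v - joint s u <= (size s)%:R * (fine (cdf (X 0%N) v) - fine (cdf (X 0%N) u)).
Proof.
move=> uv; apply: le_trans (joint_increment s uv) _.
rewrite mulr_natl; elim: s => [|j s IH]; first by rewrite big_nil mulr0n.
rewrite big_cons /= mulrS; apply: lerD IH.
by rewrite !(joint_iota j 1) !joint1.
Qed.

End JointDistribution.

(** * Lipschitz approximation of indicators of orthants *)

Section SoftThreshold.
Context (R : realType).
Implicit Types (u e : R).

(* Thresholding the sum of the overshoots rather than their maximum makes the
   Lipschitz bound for [l1dist] immediate. *)
Definition soft n u e (x : n.-tuple R) : R := Num.max (1 - overshoot u x / e) 0.

Lemma soft_ge0 n u e (x : n.-tuple R) : 0 <= soft u e x.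
Proof. by rewrite /soft le_max lexx orbT. Qed.

Lemma soft_le1 n u e (x : n.-tuple R) : 0 < e -> soft u e x <= 1.
Proof.
move=> e0; rewrite /soft ge_max ler01 andbT lerBlDr lerDl.
by rewrite divr_ge0 ?overshoot_ge0 // ltW.
Qed.

Lemma measurable_soft n u e : measurable_fun [set: n.-tuple R] (@soft n u e).
Proof.
apply: (@measurable_maxr _ _ R setT (fun x : n.-tuple R => 1 - overshoot u x / e) (cst 0)) => //.
apply: measurable_funB => //; apply: measurable_funM => //.
exact: measurable_overshoot.
Qed.

(** A single coordinate above [u + e] already makes the overshoot exceed [e], so that [soft]
    vanishes. *)
Lemma soft_below n u e (x : n.-tuple R) : 0 < e ->
  (all (fun y => y <= u) x)%:R <= soft u e x <= (all (fun y => y <= u + e) x)%:R.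
Proof.
move=> e0; apply/andP; split.
  case h : all; last exact: soft_ge0.
  by move: h; rewrite -overshoot_eq0 /soft => /eqP ->; rewrite mul0r subr0 le_max lexx.
case h : all; first exact: soft_le1.
rewrite /soft ge_max lexx andbT subr_le0 ler_pdivlMr // mul1r.
move/negbT: h; rewrite -has_predC => /hasP[y /tnthP[k ->]] /=; rewrite -ltNge => hk.
rewrite /overshoot (bigD1 k) //=.
have : 0 <= \sum_(i < n | i != k) Num.max (tnth x i - u) 0.
  by apply: sumr_ge0 => i _; rewrite le_max lexx orbT.
have : tnth x k - u <= Num.max (tnth x k - u) 0 by rewrite le_max lexx.
lra.
Qed.

Lemma normr_max0B (x y : R) : `|Num.max x 0 - Num.max y 0| <= `|x - y|.
Proof.
wlog xy : x y / y <= x => [wl|].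
  by have [/wl//|/ltW/wl] := leP y x; rewrite distrC [`|y - x|]distrC.
have h : Num.max y 0 <= Num.max x 0 by rewrite ge_max !le_max xy lexx orbT.
rewrite !ger0_norm ?subr_ge0 //.
case: (leP x 0) (leP y 0) h => hx [hy|hy] h; lra.
Qed.

Lemma soft_lipschitz n u e (x y : n.-tuple R) : 0 < e ->
  `|soft u e y - soft u e x| <= l1dist x y / e.
Proof.
move=> e0; apply: le_trans (normr_max0B _ _) _.
have -> : 1 - overshoot u y / e - (1 - overshoot u x / e) =
  (overshoot u x - overshoot u y) / e by ring.
rewrite normrM normfV (gtr0_norm e0) ler_wpM2r ?invr_ge0 ?(ltW e0) //.
rewrite distrC /overshoot -sumrB; apply: le_trans (ler_norm_sum _ _ _) _.
apply: ler_sum => k _; apply: le_trans (normr_max0B _ _) _.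
by rewrite (_ : tnth y k - u - (tnth x k - u) = tnth y k - tnth x k) //; ring.
Qed.

Lemma test_function_soft n u e : 0 < e -> test_function (@soft n.+1 u e).
Proof.
move=> e0; split; first exact: measurable_soft.
  exists (nseq_tuple n.+1 u), (nseq_tuple n.+1 (u + e + 1)) => h.
  have hx : all (fun y => y <= u) (nseq_tuple n.+1 u) by rewrite all_nseq lexx orbT.
  have hy : all (fun y => y <= u + e) (nseq_tuple n.+1 (u + e + 1)) = false.
    by rewrite all_nseq /=; lra.
  have := soft_below u (nseq_tuple n.+1 u) e0.
  have := soft_below u (nseq_tuple n.+1 (u + e + 1)) e0.
  by rewrite h hx hy => /andP[_ h0] /andP[/le_trans/(_ h0)]; rewrite ler_nat.
by move=> x; rewrite ger0_norm ?soft_ge0 // soft_le1.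
Qed.

Lemma l1dist_ge0 n (x y : n.-tuple R) : 0 <= l1dist x y.
Proof. exact: sumr_ge0. Qed.

Lemma Lip_soft_le n u e : 0 < e -> (Lip (@soft n u e) <= (e^-1)%:E)%E.
Proof.
move=> e0; apply: ge_ereal_sup => _ [[x y] _ <-] /=; rewrite lee_fin.
have := soft_lipschitz u x y e0; have := l1dist_ge0 x y.
(* At distance 0 the quotient is 0, by the convention [0^-1 = 0]. *)
rewrite le_eqVlt => /predU1P[<- _|l0 h]; first by rewrite invr0 mulr0 invr_ge0 ltW.
by rewrite ler_pdivrMr // mulrC.
Qed.

(** Together with the finite upper bound, this makes the ratio in [eta] an ordinary quotient of
    reals. *)
Lemma Lip_soft_gt0 n u e : 0 < e -> (0 < Lip (@soft n.+1 u e))%E.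
Proof.
move=> e0; have [_ [x [y fxy]] _] := test_function_soft n u e0.
apply: (@lt_le_trans _ _ (`|soft u e y - soft u e x| / l1dist x y)%:E); last first.
  by apply: ereal_sup_ubound; exists (x, y) => //=; apply/eqP => yx; apply: fxy; rewrite yx.
have d0 : 0 < `|soft u e y - soft u e x|.
  by rewrite normr_gt0 subr_eq0; apply/eqP => h; exact: fxy.
rewrite lte_fin divr_gt0 //.
have := lt_le_trans d0 (soft_lipschitz u x y e0).
by rewrite pmulr_lgt0 // invr_gt0.
Qed.

End SoftThreshold.

(** * From the eta coefficient to joint distributions *)

Section EtaMixing.
Context (d : measure_display) (T : measurableType d) (R : realType) (P : probability T R).
Context (X : nat -> {RV P >-> R}).

Lemma measurable_vec n (k : n.-tuple nat) : measurable_fun [set: T] (vec X k).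
Proof.
apply/measurable_fun_tnthP => i.
rewrite (_ : _ \o _ = X (tnth k i)); first exact: measurable_funP.
by apply/funext => w /=; rewrite tnth_map.
Qed.

Lemma bounded_soft n (k : n.-tuple nat) (u e : R) : 0 < e -> bounded_rv (soft u e \o vec X k).
Proof.
move=> e0; split.
  by apply: measurableT_comp; [exact: measurable_soft|exact: measurable_vec].
by exists 1 => w /=; rewrite ger0_norm ?soft_ge0 ?soft_le1.
Qed.

(** Soft thresholds are test functions with Lipschitz constant at most [1 / e], so the denominator
    in [eta] is at most [(s.+1 + t.+1) / e]. *)
Lemma covariance_soft_le s t (i : s.+1.-tuple nat) (j : t.+1.-tuple nat) r (u e h : R) :
  0 < e -> 0 <= h -> sorted leq (i ++ j) -> (r <= tnth j ord0 - tnth i ord_max)%N ->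
  (eta X r <= h%:E)%E ->
  `|mean P (fun w => soft u e (vec X i w) * soft u e (vec X j w)) -
    mean P (soft u e \o vec X i) * mean P (soft u e \o vec X j)| <=
  h * ((s.+1 + t.+1)%:R / e).
Proof.
move=> e0 h0 sij gap eta_h.
set K := mean _ _ - _.
have covE : covariance P (soft u e \o vec X i) (soft u e \o vec X j) = K%:E.
  by rewrite covariance_mean //; exact: bounded_soft.
pose f := @soft R s.+1 u e; pose g := @soft R t.+1 u e.
have Lfin n : exists2 l, @Lip R n.+1 (soft u e) = l%:E & 0 < l <= e^-1.
  have := Lip_soft_le n.+1 u e0; have := Lip_soft_gt0 n u e0.
  by case: Lip => // l; rewrite lte_fin lee_fin => l0 le; exists l; rewrite ?l0.
have [lf Elf /andP[lf0 lfe]] := Lfin s.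
have [lg Elg /andP[lg0 lge]] := Lfin t.
set D := s.+1%:R * lf + t.+1%:R * lg.
have D0 : 0 < D by rewrite addr_gt0 // mulr_gt0.
have : (`|K|%:E / D%:E <= h%:E)%E.
  apply: le_trans eta_h; apply: ereal_sup_ubound.
  exists s, t, f, g, i, j; split=> //.
    by split; exact: test_function_soft.
  by rewrite covE Elf Elg -!EFinM -EFinD.
rewrite inver gt_eqF // -EFinM lee_fin ler_pdivrMr // => /le_trans; apply.
rewrite ler_wpM2l // natrD mulrDl; apply: lerD; rewrite ler_wpM2l //.
Qed.

Lemma joint_soft n (k : n.-tuple nat) (u e : R) : 0 < e ->
  joint X k u <= mean P (soft u e \o vec X k) <= joint X k (u + e).
Proof.
move=> e0; apply/andP; split; (apply: mean_le => [||w /=];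
  [by [exact: bounded_below|exact: bounded_soft]|by [exact: bounded_below|exact: bounded_soft]|]);
  by have := soft_below u (vec X k w) e0; rewrite /below /= !all_map => /andP[].
Qed.

Lemma joint_soft2 n m (k : n.-tuple nat) (l : m.-tuple nat) (u e : R) : 0 < e ->
  joint X (k ++ l) u <= mean P (fun w => soft u e (vec X k w) * soft u e (vec X l w))
    <= joint X (k ++ l) (u + e).
Proof.
move=> e0; have bs := bounded_rvM (bounded_soft k u e0) (bounded_soft l u e0).
apply/andP; split; (apply: mean_le => [||w /=];
  [by [exact: bounded_below|exact: bs]|by [exact: bounded_below|exact: bs]|]);
  rewrite below_cat; have := soft_below u (vec X k w) e0; have := soft_below u (vec X l w) e0;
  rewrite /below /= !all_map => /andP[? ?] /andP[? ?];
  by apply: ler_pM; rewrite ?soft_ge0 ?ler0n.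
Qed.

Context (X_stationary : strictly_stationary X).
Local Notation F := (fun u => fine (cdf (X 0%N) u)).

(** Replacing indicators by soft thresholds costs one increment of [F] per index, and the covariance
    of the latter costs [h / e] per index. *)
Lemma joint_cat_approx s t (i : s.+1.-tuple nat) (j : t.+1.-tuple nat) r (u e h : R) :
  0 < e -> 0 <= h -> sorted leq (i ++ j) -> (r <= tnth j ord0 - tnth i ord_max)%N ->
  (eta X r <= h%:E)%E ->
  `|joint X (i ++ j) u - joint X i u * joint X j u| <=
  (s.+1 + t.+1)%:R * (F (u + e) - F u + h / e).
Proof.
move=> e0 h0 sij gap eta_h.
have := covariance_soft_le u e0 h0 sij gap eta_h.
have /andP[] := joint_soft2 i j u e0.
have /andP[] := joint_soft i u e0; have /andP[] := joint_soft j u e0.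
have ue : u <= u + e by rewrite lerDl ltW.
have := joint_modulus X_stationary i ue; have := joint_modulus X_stationary j ue.
have := joint_modulus X_stationary (i ++ j) ue.
rewrite size_cat !size_tuple !natrD.
have := joint_ge0 X i u; have := joint_ge0 X j u.
have := joint_le1 X i u; have := joint_le1 X j u.
have := joint_le1 X i (u + e); have := joint_le1 X j (u + e).
set a := joint X i u; set b := joint X j u; set a' := joint X i _; set b' := joint X j _.
set m := joint X _ u; set m' := joint X _ _.
set f := mean P (_ \o vec X i); set g := mean P (_ \o vec X j); set fg := mean P _.
set rho := fine _ - fine _.
move=> a'1 b'1 a1 b1 a0 b0 hm hb ha bg gb' af fa' mfg fgm'.
have h1 : a * b <= f * g by apply: ler_pM.
have h2 : f * g <= a' * b'.
  by apply: ler_pM => //; [exact: le_trans af|exact: le_trans bg].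
(* Used to bound [a' * b' - a * b = a' * (b' - b) + b * (a' - a)] by the increments of the two
   blocks. *)
have h3 : a' * (b' - b) <= b' - b by rewrite ler_piMl //; lra.
have h4 : b * (a' - a) <= a' - a by rewrite ler_piMl //; lra.
rewrite !ler_distl => /andP[k1 k2]; apply/andP; split; lra.
Qed.

End EtaMixing.

(** * Rates *)

Lemma powR_neg_small (R : realType) (k c e : R) : 0 < k -> 0 <= c -> 0 < e ->
  exists r0 : nat, forall r : nat, (r0 <= r)%N -> c * r%:R `^ (- k) <= e.
Proof.
move=> k0 c0 e0; exists (Num.truncn ((c / e) `^ k^-1)).+1 => r hr.
have hr' : (c / e) `^ k^-1 <= r%:R.
  by apply: le_trans (ltW (truncnS_gt _)) _; rewrite ler_nat.
have r0 : 0 < r%:R :> R by rewrite ltr0n; apply: leq_trans hr.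
rewrite powRN ler_pdivrMr ?powR_gt0 // mulrC -ler_pdivrMr //.
have -> : c / e = ((c / e) `^ k^-1) `^ k.
  by rewrite -powRrM mulVf ?gt_eqF // powRr1 // divr_ge0 // ltW.
by apply: ge0_ler_powR; rewrite ?nnegrE ?powR_ge0 // ltW.
Qed.



(** * Almost multiplicativity for eta-weakly dependent sequences *)

Section PhantomOfEtaMixing.
Context (d : measure_display) (T : measurableType d) (R : realType)
    (P : probability T R) (X : nat -> {RV P >-> R}) (b B beta : R)
    (X_stationary : strictly_stationary X)
    (F_continuous : continuous (fun x : R => fine (cdf (X 0%N) x)))
    (b_gt0 : 0 < b) (B_gt0 : 0 < B)
    (F_holder : forall x u : R, 0 < u ->
       fine (cdf (X 0%N) (x + u)) - fine (cdf (X 0%N) x) <= B * u `^ b)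
    (beta_gt : 2 * (1 + 1 / b) < beta)
    (eta_bigO : exists C : R,
       \forall r \near \oo, (eta X r <= (C * r%:R `^ (- beta))%:E)%E).

Local Notation F := (fun u => fine (cdf (X 0%N) u)).

Definition below_level n u : R := joint X (iota 0 n) u.

(** Two blocks have at most [2 * r ^+ 2] indices. For [eps = r ^ -(2/b + k)] the term in [B] has
    order [r ^ -(k b)] and, since [beta = 2 (1 + 1/b) + 2 k], the term in [h] has order [r ^ -k]. *)
Lemma error_rate (e : R) : 0 < e ->
  exists r0, forall r, (r0 <= r)%N -> exists eps h : R,
    [/\ 0 < eps, 0 <= h, (eta X r <= h%:E)%E &
      2 * r%:R ^+ 2 * (B * eps `^ b + h / eps) <= e].
Proof.
move=> e0; have [C [r1 _ hC]] := eta_bigO.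
pose k := (beta - 2 * (1 + 1 / b)) / 2.
have k0 : 0 < k by rewrite divr_gt0 // subr_gt0.
have [r2 h2] := powR_neg_small (mulr_gt0 k0 b_gt0)
  (mulr_ge0 (ler0n R 2) (ltW B_gt0)) (divr_gt0 e0 (ltr0n R 2)).
have [r3 h3] := powR_neg_small k0
  (mulr_ge0 (ler0n R 2) (normr_ge0 C)) (divr_gt0 e0 (ltr0n R 2)).
exists (maxn r1 (maxn r2 r3)).+1 => r hr.
have rn : (0 < r)%N by apply: leq_trans hr.
have r0 : 0 < r%:R :> R by rewrite ltr0n.
have rneq : r%:R != 0 :> R by rewrite gt_eqF.
move: (ltnW hr); rewrite !geq_max => /and3P[hr1 hr2 hr3].
(* The absolute value of [C] ensures [h >= 0] whatever the sign of [C]. *)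
exists (r%:R `^ (- (2 / b + k))), (`|C| * r%:R `^ (- beta)); split.
- exact: powR_gt0.
- by rewrite mulr_ge0 // powR_ge0.
- by apply: le_trans (hC r hr1) _; rewrite lee_fin ler_wpM2r ?powR_ge0 // ler_norm.
have E2 : r%:R ^+ 2 = r%:R `^ 2 :> R by rewrite powR_mulrn.
have -> : 2 * r%:R ^+ 2 * (B * r%:R `^ (- (2 / b + k)) `^ b +
     `|C| * r%:R `^ (- beta) / r%:R `^ (- (2 / b + k))) =
   2 * B * (r%:R ^+ 2 * r%:R `^ (- (2 / b + k)) `^ b) +
   2 * `|C| * (r%:R ^+ 2 * (r%:R `^ (- beta) / r%:R `^ (- (2 / b + k)))) by ring.
have -> : r%:R ^+ 2 * r%:R `^ (- (2 / b + k)) `^ b = r%:R `^ (- (k * b)) :> R.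
  rewrite E2 -powRrM -powRD ?rneq ?implybT //; congr (_ `^ _).
  by field; rewrite gt_eqF.
have -> : r%:R ^+ 2 * (r%:R `^ (- beta) / r%:R `^ (- (2 / b + k))) = r%:R `^ (- k) :> R.
  rewrite E2 -powRB ?rneq ?implybT // -powRD ?rneq ?implybT //; congr (_ `^ _).
  by rewrite /k; field; rewrite gt_eqF.
by rewrite [leRHS](splitr e) lerD ?h2 ?h3.
Qed.

Lemma below_level0 u : below_level 0 u = 1. Proof. exact: joint_nil. Qed.

Lemma below_level_ge0 n u : 0 <= below_level n u. Proof. exact: joint_ge0. Qed.

Lemma below_level_anti u m n : (m <= n)%N -> below_level n u <= below_level m u.
Proof.
by move=> mn; apply: joint_anti => j; rewrite !mem_iota !add0n /= => /leq_trans; apply.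
Qed.

Lemma below_level_drop u q r :
  below_level q u - below_level (q + r)%N u <= 1 - below_level r u.
Proof.
rewrite /below_level iotaD -[in X in _ <= 1 - X](joint_iota X_stationary (0 + q)).
exact: joint_drop.
Qed.

Lemma below_level_homo n u v : u <= v -> below_level n u <= below_level n v.
Proof. exact: joint_homo. Qed.

(** Dropping the [r] indices of the gap from the event gives the upper bound; inserting them by
    [joint_insert] gives the lower one. *)
Lemma below_level_mixing e : 0 < e ->
  exists r0, forall r, (r0 <= r)%N -> mixing_at below_level r e.
Proof.
move=> e0; have [r0 rate] := error_rate e0.
exists r0 => r /rate [eps [h [eps0 h0 eta_h le_e]]] u p q hp hq.
(* Empty blocks are treated apart: the tuples in [eta] have at least one index. *)
case: p hp => [|p] hp.
  rewrite below_level0 mul1r add0n; split.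
    by rewrite ler_wpDr ?(ltW e0) // below_level_anti ?leq_addl.
  by have := below_level_drop u q r; rewrite addnC; lra.
case: q hq => [|q] hq.
  rewrite below_level0 mulr1 addn0; split.
    by rewrite ler_wpDr ?(ltW e0) // below_level_anti ?leq_addr.
  by have := below_level_drop u p.+1 r; lra.
pose i := [tuple of iota 0 p.+1]; pose j := [tuple of iota (p.+1 + r) q.+1].
have full : iota 0 (p.+1 + r + q.+1) = iota 0 p.+1 ++ iota p.+1 r ++ iota (p.+1 + r) q.+1.
  by rewrite !iotaD catA !add0n.
have sub : subseq (i ++ j) (iota 0 (p.+1 + r + q.+1)).
  by rewrite full cat_subseq // suffix_subseq.
have sij : sorted leq (i ++ j) by apply: subseq_sorted sub (iota_sorted _ _); exact: leq_trans.
(* The blocks end at [p] and start at [p.+1 + r], so the difference is [r.+1]. *)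
have gap : (r <= tnth j ord0 - tnth i ord_max)%N.
  have -> : tnth i ord_max = p by rewrite (tnth_nth 0%N); exact: (nth_iota 0 0 (ltnSn p)).
  by rewrite (tnth_nth 0%N) /= addSn addnC subSn ?leq_addl // addnK.
have := joint_cat_approx X_stationary u eps0 h0 sij gap eta_h.
rewrite (joint_iota X_stationary (p.+1 + r)) -/(below_level _ _) -/(below_level _ _).
have le1 : (p.+1 + q.+1)%:R <= 2 * r%:R ^+ 2 :> R.
  by rewrite -natrX -natrM ler_nat mul2n -addnn leq_add.
have le2 : (p.+1 + q.+1)%:R * (F (u + eps) - F u + h / eps) <= e.
  apply: le_trans le_e; apply: ler_pM => //.
    rewrite addr_ge0 ?divr_ge0 ?(ltW eps0) // subr_ge0 fine_le ?fin_num_measure //.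
    by apply: cdf_nondecreasing; rewrite lerDl ltW.
  by rewrite lerD2r F_holder.
have lo : joint X (i ++ j) u - (1 - below_level r u) <= below_level (p.+1 + r + q.+1) u.
  rewrite /below_level full -(joint_iota X_stationary p.+1); exact: joint_insert.
have up : below_level (p.+1 + r + q.+1) u <= joint X (i ++ j) u.
  by apply: joint_anti => x; apply: mem_subseq.
by rewrite ler_distl => /andP[k1 k2]; split; lra.
Qed.

Lemma below_level1 u : below_level 1 u = F u. Proof. exact: joint1. Qed.

Lemma below_level_continuous n : continuous (below_level n).
Proof.
move=> u; apply/cvgrPdist_le => e e0.
have n0 : 0 < n.+1%:R :> R by rewrite ltr0n.
have /cvgrPdist_le /(_ _ (divr_gt0 e0 n0)) := @F_continuous u.
apply: filterS => v; rewrite ler_pdivlMr // => h; apply: le_trans h.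
have key x y : x <= y -> `|below_level n x - below_level n y| <= `|F x - F y| * n.+1%:R.
  move=> xy; have Fxy : F x <= F y by rewrite -!below_level1 below_level_homo.
  rewrite distrC ger0_norm ?subr_ge0 ?below_level_homo // distrC ger0_norm ?subr_ge0 //.
  apply: le_trans (joint_modulus X_stationary _ xy) _; rewrite size_iota mulrC.
  by rewrite ler_wpM2l ?subr_ge0 // ler_nat.
have [/key//|/ltW/key] := leP u v; by rewrite distrC [`|F v - F u|]distrC.
Qed.

Lemma below_level_cvgNy : below_level 1 @ -oo --> (0 : R).
Proof.
rewrite (_ : below_level 1 = F); last exact/funext/below_level1.
exact/fine_cvg/cvg_cdfNy0.
Qed.

Lemma below_level_cvgy n : below_level n @ +oo --> (1 : R).
Proof.
have Fy : F u @[u --> +oo] --> (1 : R) by exact/fine_cvg/cvg_cdfy1.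
elim: n => [|n IH].
  by rewrite (_ : below_level 0 = cst 1); [exact: cvg_cst|exact/funext/below_level0].
apply: (@squeeze_cvgr _ _ _ _ (fun u => below_level n u - (1 - F u)) (cst 1)).
- apply: nearW => u; rewrite -below_level1 -(below_level0 u) below_level_anti // andbT.
  by have := below_level_drop u n 1; rewrite addn1 below_level0; lra.
- rewrite -[X in _ --> X]subr0 -(subrr (1 : R)).
  by apply: cvgB => //; apply: cvgB => //; exact: cvg_cst.
- exact: cvg_cst.
Qed.

Lemma partial_maxE n u :
  fine (P [set w | partial_max X n.+1 w <= u]) = below_level n.+1 u.
Proof.
rewrite /below_level jointE; congr (fine (P _)); apply/seteqP; split=> w.
  move=> /bigmax_leP[_ h]; apply/allP => j; rewrite mem_iota add0n => /= jn.
  exact: h (Ordinal jn) isT.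
move/allP => h; apply/bigmax_leP; split; first by apply: (h 0%N); rewrite mem_iota.
by move=> j _; apply: (h j); rewrite mem_iota add0n /= ltn_ord.
Qed.

End PhantomOfEtaMixing.

(** The uniform bounds make the supremum eventually finite, after which the limit is taken among
    real numbers. *)
Lemma phantom_distribution_of_uniform (d : measure_display)
    (T : measurableType d) (R : realType) (P : probability T R)
    (X : nat -> {RV P >-> R}) (G : cumulativeBounded (0 : R) (1 : R)) :
  (forall e : R, 0 < e -> exists n0, forall n u, (n0 <= n)%N ->
     `|fine (P [set w | partial_max X n w <= u]) - G u ^+ n| <= e) ->
  phantom_distribution X G.
Proof.
move=> unif.
have bnd (e : R) n : (forall u, `|fine (P [set w | partial_max X n w <= u]) - G u ^+ n| <= e) ->
    (0 <= ereal_sup [set `|fine (P [set w | partial_max X n w <= u]) - G u ^+ n|%:E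
       | u in [set: R]] <= e%:E)%E.
  move=> h; apply/andP; split; last by apply: ge_ereal_sup => _ [u _ <-]; rewrite lee_fin.
  apply: (@le_trans _ _ `|fine (P [set w | partial_max X n w <= 0]) - G 0 ^+ n|%:E).
    by rewrite lee_fin.
  by apply: ereal_sup_ubound; exists 0.
apply/fine_cvgP; split.
  have [n0 h] := unif 1 ltr01; exists n0 => // n /= hn.
  have /andP[lo up] := bnd 1 n (fun u => h n u hn).
  by rewrite ge0_fin_numE //; apply: le_lt_trans up (ltry _).
apply/cvgrPdist_le => e e0.
have [n0 h] := unif e e0; exists n0 => // n /= hn.
have /andP[lo up] := bnd e n (fun u => h n u hn).
rewrite sub0r normrN ger0_norm ?fine_ge0 // -lee_fin fineK //.
by rewrite ge0_fin_numE //; apply: le_lt_trans up (ltry _).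
Qed.

Theorem theorem4p8 (d : measure_display) (T : measurableType d) (R : realType)
    (P : probability T R) (X : nat -> {RV P >-> R}) (b B beta : R)
    (X_stationary : strictly_stationary X)
    (F_continuous : continuous (fun x : R => fine (cdf (X 0%N) x)))
    (b_gt0 : 0 < b) (B_gt0 : 0 < B)
    (F_holder : forall x u : R, 0 < u ->
       fine (cdf (X 0%N) (x + u)) - fine (cdf (X 0%N) x) <= B * u `^ b)
    (X_eta : eta_weakly_dependent X)
    (beta_gt : 2 * (1 + 1 / b) < beta)
    (eta_bigO : exists C : R,
       \forall r \near \oo, (eta X r <= (C * r%:R `^ (- beta))%:E)%E) :
  exists G : cumulativeBounded (0 : R) (1 : R),
    continuous G /\ phantom_distribution X G.
Proof.
have [G [G_cont unif]] := phantom_exists (below_level0 X) (below_level_ge0 X)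
  (below_level_anti X) (below_level_drop X_stationary)
  (below_level_mixing X_stationary b_gt0 B_gt0 F_holder beta_gt eta_bigO)
  (below_level_homo X) (below_level_continuous X_stationary F_continuous)
  (below_level_cvgNy X) (below_level_cvgy X_stationary).
exists G; split=> //; apply: phantom_distribution_of_uniform => e e0.
(* Starting at [n0.+1] excludes [n = 0], where [partial_max] takes its default value while
   [below_level] is 1. *)
have [n0 h] := unif e e0; exists n0.+1 => -[//|n] u hn.
by rewrite partial_maxE; apply: h; exact: ltnW.
Qed.
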